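(* Let $R:\mathbb{R}^n\to\mathbb{R}\cup\{+\infty\}$ be proper, lower semicontinuous and bounded from below, and let $F:\mathbb{R}^n\to\mathbb{R}$ be differentiable with $L$-Lipschitz continuous gradient. Assume that $\Phi=R+F$ is a proper lower semicontinuous KL function which is bounded from below. Consider the MiFB algorithm with $s\ge 1$, and choose $\mu,\nu>0$ and the parameters $\gamma_k,a_{i,k},b_{i,k}$ such that $$\delta:=\underline{\beta}-\sum_{i\in I}\bar\alpha_i>0 .$$ Then each bounded sequence $\{x_k\}_{k\in\mathbb{N}}$ generated by the algorithm satisfies: (i) $\{x_k\}_{k\in\mathbb{N}}$ has finite length, i.e. $\sum_{k\in\mathbb{N}}\|x_k-x_{k-1}\|<+\infty$; (ii) there exists a critical point $x^\star\in\mathrm{crit}(\Phi)$ such that $\lim_{k\to\infty}x_k=x^\star$. (iii) Moreover, if $\Phi$ has the Kurdyka–Łojasiewicz property at a global minimizer $x^\star$ of $\Phi$, then, starting sufficiently close to $x^\star$ (i.e. for every starting point $x_0$ in a sufficiently small neighbourhood of $x^\star$), any sequence $\{x_k\}_{k\in\mathbb{N}}$ generated by the algorithm converges to a global minimizer of $\Phi$ and satisfies (i).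
   Context: $\mathbb{R}^n$ carries the standard inner product and norm. No convexity is assumed. Proximity operator (set-valued): $\mathrm{prox}_{\gamma R}(z)=\mathrm{Argmin}_{x\in\mathbb{R}^n}\ \tfrac12\|x-z\|^2+\gamma R(x)$. MiFB algorithm: let $s\ge1$ be an integer, $I=\{0,1,\dots,s-1\}$, $x_0\in\mathbb{R}^n$, $x_{-s}=\dots=x_{-1}=x_0$. For each $k\in\mathbb{N}$ take $\gamma_k$ with $0<\underline\gamma\le\gamma_k\le\bar\gamma<\frac1L$, and $a_{i,k},b_{i,k}\in\,]-1,2]$ for $i\in I$, and set $$y_{a,k}=x_k+\sum_{i\in I}a_{i,k}(x_{k-i}-x_{k-i-1}),\quad y_{b,k}=x_k+\sum_{i\in I}b_{i,k}(x_{k-i}-x_{k-i-1}),\quad x_{k+1}\in\mathrm{prox}_{\gamma_kR}\big(y_{a,k}-\gamma_k\nabla F(y_{b,k})\big).$$ Constants: for $\mu,\nu>0$, $$\beta_k=\frac{1-\gamma_kL-\mu-\nu\gamma_k}{2\gamma_k},\quad \underline\beta=\liminf_{k}\beta_k,\quad \alpha_{k,i}=\frac{s\,a_{i,k}^2}{2\gamma_k\mu}+\frac{s\,b_{i,k}^2L^2}{2\nu},\quad \bar\alpha_i=\limsup_k\alpha_{k,i}.$$ Subdifferentials: for $J$ lower semicontinuous and $x\in\mathrm{dom}(J)$, the Fréchet subdifferential $\partial^FJ(x)$ is the set of $v$ with $\liminf_{z\to x,z\ne x}\frac{1}{\|x-z\|}(J(z)-J(x)-\langle v,z-x\rangle)\ge0$;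 the (limiting) subdifferential is $\partial J(x)=\{v:\exists x_k\to x,\ J(x_k)\to J(x),\ v_k\in\partial^FJ(x_k),\ v_k\to v\}$. $\mathrm{dom}(\partial J)=\{x:\partial J(x)\neq\emptyset\}$, $\mathrm{crit}(J)=\{x:0\in\partial J(x)\}$. KL property: a proper lower semicontinuous $J$ has the Kurdyka–Łojasiewicz property at $\bar x\in\mathrm{dom}(J)$ if there are $\eta\in\,]0,+\infty]$, a neighbourhood $U$ of $\bar x$ and a continuous concave $\varphi:[0,\eta[\to\mathbb{R}_+$ such that $\varphi(0)=0$, $\varphi$ is $C^1$ on $]0,\eta[$ with $\varphi'>0$ there, and for all $x\in U$ with $J(\bar x)<J(x)<J(\bar x)+\eta$, $\varphi'(J(x)-J(\bar x))\,\mathrm{dist}(0,\partial J(x))\ge1$. $J$ is a KL function if it has this property at each point of $\mathrm{dom}(\partial J)$. *)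

(* Defs.v *)
From HB Require Import structures.
From mathcomp Require Import all_boot all_order all_algebra.
From mathcomp Require Import all_classical all_reals all_analysis.

Set Implicit Arguments.
Unset Strict Implicit.
Unset Printing Implicit Defensive.
Import Order.TTheory GRing.Theory Num.Theory.
Import numFieldNormedType.Exports.
Local Open Scope classical_set_scope.
Local Open Scope ring_scope.

(* The library norm [`|x|] on ['rV[K]_n] is the sup norm, so the Euclidean
   structure of R^n is defined here.  Both norms induce the same topology, so
   the library's limits, neighbourhoods and differentials are used as is. *)
Definition dotp (K : realType) (n : nat) (u v : 'rV[K]_n) : K :=
  \sum_(i < n) u 0 i * v 0 i.

Definition enorm (K : realType) (n : nat) (u : 'rV[K]_n) : K :=
  Num.sqrt (dotp u u).

Definition edistance (K : realType) (n : nat) (x : 'rV[K]_n)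
    (A : set 'rV[K]_n) : \bar K :=
  ereal_inf [set (enorm (x - v))%:E | v in A].

Definition grad (K : realType) (n : nat) (F : 'rV[K]_n -> K) (x : 'rV[K]_n) :
    'rV[K]_n :=
  \row_(i < n) 'd F x (delta_mx 0 i).

Definition elipschitz (K : realType) (n : nat) (L : K)
    (G : 'rV[K]_n -> 'rV[K]_n) : Prop :=
  forall x y, enorm (G x - G y) <= L * enorm (x - y).

Definition edom (K : realType) (T : Type) (J : T -> \bar K) : set T :=
  [set x | (J x < +oo)%E].

Definition eproper (K : realType) (T : Type) (J : T -> \bar K) : Prop :=
  (forall x, (-oo < J x)%E) /\ edom J !=set0.

Definition bounded_below (K : realType) (T : Type) (J : T -> \bar K) : Prop :=
  exists m : K, forall x, (m%:E <= J x)%E.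

Definition argmin (K : realType) (T : Type) (J : T -> \bar K) : set T :=
  [set x | forall y, (J x <= J y)%E].

Definition prox (K : realType) (n : nat) (gamma : K) (R : 'rV[K]_n -> \bar K)
    (z : 'rV[K]_n) : set 'rV[K]_n :=
  argmin (fun x => ((2^-1 * enorm (x - z) ^+ 2)%:E + gamma%:E * R x)%E).

Definition frechet_subdiff (K : realType) (n : nat) (J : 'rV[K]_n -> \bar K)
    (x : 'rV[K]_n) : set 'rV[K]_n :=
  [set v | edom J x /\
    (0 <= limf_einf (fun z : 'rV[K]_n =>
            ((enorm (x - z))^-1)%:E * (J z - J x - (dotp v (z - x))%:E))
          x^')%E].

(* Both subdifferentials are empty outside of [edom J]; without the first
   conjunct, sequences with [J (u k) --> +oo] would be allowed below. *)
Definition subdiff (K : realType) (n : nat) (J : 'rV[K]_n -> \bar K)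
    (x : 'rV[K]_n) : set 'rV[K]_n :=
  [set v | edom J x /\
    exists u w : nat -> 'rV[K]_n,
      [/\ u @ \oo --> x,
          J (u k) @[k --> \oo] --> J x,
          (forall k, frechet_subdiff J (u k) (w k))
        & w @ \oo --> v]].

Definition dom_subdiff (K : realType) (n : nat) (J : 'rV[K]_n -> \bar K) :
    set 'rV[K]_n :=
  [set x | subdiff J x !=set0].

Definition crit (K : realType) (n : nat) (J : 'rV[K]_n -> \bar K) :
    set 'rV[K]_n :=
  [set x | subdiff J x 0].

Definition desingularizing (K : realType) (eta : \bar K) (phi : K -> K) : Prop :=
  let I0 : set K := [set t | 0 <= t /\ (t%:E < eta)%E] in
  let I1 : set K := [set t | 0 < t /\ (t%:E < eta)%E] in
  [/\ (forall t, I0 t -> 0 <= phi t),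
      {within I0, continuous phi},
      convex_function I0 (fun t => - phi t),
      phi 0 = 0
    & forall t, I1 t ->
        [/\ derivable phi t 1, {for t, continuous (derive1 phi)} & 0 < derive1 phi t]].

(* The distance to an empty subdifferential is [+oo]. *)
Definition KL_at (K : realType) (n : nat) (J : 'rV[K]_n -> \bar K)
    (xbar : 'rV[K]_n) : Prop :=
  edom J xbar /\
  exists (eta : \bar K) (U : set 'rV[K]_n) (phi : K -> K),
    [/\ (0 < eta)%E, nbhs xbar U, desingularizing eta phi &
        forall x, U x -> (J xbar < J x)%E -> (J x < J xbar + eta)%E ->
          (1 <= (derive1 phi (fine (J x - J xbar)))%:E
                * edistance 0 (subdiff J x))%E].

Definition KL_function (K : realType) (n : nat) (J : 'rV[K]_n -> \bar K) : Prop :=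
  forall x, dom_subdiff J x -> KL_at J x.

(* Natural subtraction is truncated, so [x (k - i)%N] is [x 0%N] whenever the
   index would be negative: this is the convention x_{-s} = ... = x_{-1} = x_0. *)
Definition inertial (K : realType) (n s : nat) (c : 'I_s -> nat -> K)
    (x : nat -> 'rV[K]_n) (k : nat) : 'rV[K]_n :=
  x k + \sum_(i < s) c i k *: (x (k - i)%N - x (k - i - 1)%N).

Definition MiFB (K : realType) (n s : nat)
    (R : 'rV[K]_n -> \bar K) (F : 'rV[K]_n -> K)
    (gamma : nat -> K) (a b : 'I_s -> nat -> K) (x : nat -> 'rV[K]_n) : Prop :=
  forall k, prox (gamma k) R
    (inertial a x k - gamma k *: grad F (inertial b x k)) (x k.+1).

Definition MiFB_beta (K : realType) (L mu nu : K) (gamma : nat -> K)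
    (k : nat) : K :=
  (1 - gamma k * L - mu - nu * gamma k) / (2 * gamma k).

Definition MiFB_alpha (K : realType) (s : nat) (L mu nu : K) (gamma : nat -> K)
    (a b : 'I_s -> nat -> K) (k : nat) (i : 'I_s) : K :=
  s%:R * a i k ^+ 2 / (2 * gamma k * mu) + s%:R * b i k ^+ 2 * L ^+ 2 / (2 * nu).

Definition MiFB_delta (K : realType) (s : nat) (L mu nu : K) (gamma : nat -> K)
    (a b : 'I_s -> nat -> K) : \bar K :=
  (limn_einf (fun k => (MiFB_beta L mu nu gamma k)%:E)
   - \sum_(i < s) limn_esup (fun k => (MiFB_alpha L mu nu gamma a b k i)%:E))%E.

(* The term for k = 0 is zero, in accordance with x_{-1} = x_0. *)
Definition finite_length (K : realType) (n : nat) (x : nat -> 'rV[K]_n) : Prop :=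
  (\sum_(0 <= k <oo) (enorm (x k - x (k - 1)%N))%:E < +oo)%E.

(* Main.v *)
Require Import Defs.
From HB Require Import structures.
From mathcomp Require Import all_boot all_order all_algebra.
From mathcomp Require Import all_classical all_reals all_analysis.
From mathcomp Require Import ring lra.

(* The iterates decrease the Lyapunov function H = Phi + (weighted squares of the
   last s steps), by delta times the square of the new step, so the steps tend
   to 0 and, by the proximal inequality against a cluster point, Phi at any
   cluster point is the limit of H; cluster points are critical because the
   optimality condition of the proximal subproblem bounds a subgradient by the
   last s + 1 steps.

   Phi(x_k) itself need not decrease and may lie below its limit, so the
   Kurdyka-Lojasiewicz inequality is transferred from Phi to H by replacing the
   desingularizing function phi by 2 phi(t / 2) + 2 sqrt t.  Concavity then
   bounds each step by a small multiple of the sum of the previous s + 1 steps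
   plus a telescoping term, which traps the iterates near the point where the
   inequality holds and makes the steps summable.

   Near a global minimizer x*, comparison with x* in the proximal subproblem
   controls the finitely many iterations preceding the descent regime; the trap
   applies next, and a critical point close to x* in position and value has the
   value of x*. *)

Set Implicit Arguments.
Unset Strict Implicit.
Unset Printing Implicit Defensive.
Import Order.TTheory GRing.Theory Num.Theory.
Import numFieldNormedType.Exports.
Local Open Scope classical_set_scope.
Local Open Scope ring_scope.

(** * Euclidean structure *)

Lemma dotpC (K : realType) (n : nat) (u v : 'rV[K]_n) : dotp u v = dotp v u.
Proof. by apply: eq_bigr => i _; rewrite mulrC. Qed.

Lemma dotpDr (K : realType) (n : nat) (u v w : 'rV[K]_n) :
  dotp u (v + w) = dotp u v + dotp u w.
Proof. by rewrite -big_split; apply: eq_bigr => i _; rewrite !mxE mulrDr. Qed.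

Lemma dotpZr (K : realType) (n : nat) (t : K) (u v : 'rV[K]_n) :
  dotp u (t *: v) = t * dotp u v.
Proof. by rewrite mulr_sumr; apply: eq_bigr => i _; rewrite !mxE mulrCA. Qed.

Lemma dotpDl (K : realType) (n : nat) (u v w : 'rV[K]_n) :
  dotp (u + v) w = dotp u w + dotp v w.
Proof. by rewrite dotpC dotpDr ![dotp w _]dotpC. Qed.

Lemma dotpZl (K : realType) (n : nat) (t : K) (u v : 'rV[K]_n) :
  dotp (t *: u) v = t * dotp u v.
Proof. by rewrite dotpC dotpZr dotpC. Qed.

Lemma dotpNr (K : realType) (n : nat) (u v : 'rV[K]_n) :
  dotp u (- v) = - dotp u v.
Proof. by rewrite -scaleN1r dotpZr mulN1r. Qed.

Lemma dotpNl (K : realType) (n : nat) (u v : 'rV[K]_n) :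
  dotp (- u) v = - dotp u v.
Proof. by rewrite -scaleN1r dotpZl mulN1r. Qed.

Definition dotpE := (dotpDl, dotpDr, dotpNl, dotpNr, dotpZl, dotpZr).

Lemma dotpp_ge0 (K : realType) (n : nat) (u : 'rV[K]_n) : 0 <= dotp u u.
Proof. by apply: sumr_ge0 => i _; rewrite -expr2 sqr_ge0. Qed.

Lemma enorm_ge0 (K : realType) (n : nat) (u : 'rV[K]_n) : 0 <= enorm u.
Proof. exact: sqrtr_ge0. Qed.

Lemma enorm_sqr (K : realType) (n : nat) (u : 'rV[K]_n) :
  enorm u ^+ 2 = dotp u u.
Proof. by rewrite sqr_sqrtr // dotpp_ge0. Qed.

Lemma enorm0 (K : realType) (n : nat) : enorm (0 : 'rV[K]_n) = 0.
Proof.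
by apply/eqP; rewrite -sqrf_eq0 enorm_sqr -(scale0r 0) dotpZl mul0r.
Qed.

Lemma enormZ (K : realType) (n : nat) (t : K) (u : 'rV[K]_n) :
  enorm (t *: u) = `|t| * enorm u.
Proof.
by rewrite /enorm !dotpE mulrA -expr2 sqrtrM ?sqr_ge0 // sqrtr_sqr.
Qed.

Lemma enormN (K : realType) (n : nat) (u : 'rV[K]_n) : enorm (- u) = enorm u.
Proof. by rewrite -scaleN1r enormZ normrN1 mul1r. Qed.

Lemma enormB (K : realType) (n : nat) (u v : 'rV[K]_n) :
  enorm (u - v) = enorm (v - u).
Proof. by rewrite -enormN opprB. Qed.

Lemma coord_le_enorm (K : realType) (n : nat) (u : 'rV[K]_n) (i : 'I_n) :
  `|u 0 i| <= enorm u.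
Proof.
rewrite -sqrtr_sqr ler_wsqrtr // /dotp (bigD1 i) //= -expr2 lerDl.
by apply: sumr_ge0 => j _; rewrite -expr2 sqr_ge0.
Qed.

Lemma enorm_eq0 (K : realType) (n : nat) (u : 'rV[K]_n) :
  enorm u = 0 -> u = 0.
Proof.
move=> u0; apply/rowP => i; rewrite mxE; apply/eqP.
by rewrite -normr_eq0 eq_le normr_ge0 andbT -u0 coord_le_enorm.
Qed.

Lemma cauchy_schwarz (K : realType) (n : nat) (u v : 'rV[K]_n) :
  dotp u v <= enorm u * enorm v.
Proof.
have := dotpp_ge0 (enorm v *: u - enorm u *: v).
rewrite !dotpE (dotpC v u) -!enorm_sqr => h.
have : 0 <= (enorm u * enorm v) * (enorm u * enorm v - dotp u v) by lra.
have := mulr_ge0 (enorm_ge0 u) (enorm_ge0 v).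
rewrite le_eqVlt => /predU1P[/esym/eqP|uv]; last by rewrite pmulr_rge0 // subr_ge0.
rewrite mulf_eq0 => /orP[] /eqP /[dup] /enorm_eq0 -> -> _.
  by rewrite -(scale0r 0) dotpZl !mul0r.
by rewrite -(scale0r 0) dotpZr mul0r mulr0.
Qed.

Lemma young (K : realType) (n : nat) (t : K) (u v : 'rV[K]_n) : 0 < t ->
  dotp u v <= t / 2 * enorm u ^+ 2 + enorm v ^+ 2 / (2 * t).
Proof.
move=> t0; have := dotpp_ge0 (t *: u - v).
rewrite !dotpE (dotpC v u) -!enorm_sqr => h.
have -> : t / 2 * enorm u ^+ 2 + enorm v ^+ 2 / (2 * t) =
  (t * (t * enorm u ^+ 2) + enorm v ^+ 2) / (2 * t) by field; rewrite gt_eqF.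
by rewrite ler_pdivlMr ?mulr_gt0 //; lra.
Qed.

Lemma enormD (K : realType) (n : nat) (u v : 'rV[K]_n) :
  enorm (u + v) <= enorm u + enorm v.
Proof.
rewrite -(ler_pXn2r (n := 2)) ?nnegrE ?addr_ge0 ?enorm_ge0 //.
rewrite enorm_sqr !dotpE (dotpC v u) -!enorm_sqr.
by have := cauchy_schwarz u v; lra.
Qed.

Lemma enorm_sub_trans (K : realType) (n : nat) (u v w : 'rV[K]_n) :
  enorm (u - w) <= enorm (u - v) + enorm (v - w).
Proof. by have := enormD (u - v) (v - w); rewrite addrA subrK. Qed.

Lemma enorm_sum (K : realType) (n s : nat) (u : 'I_s -> 'rV[K]_n) :
  enorm (\sum_(i < s) u i) <= \sum_(i < s) enorm (u i).
Proof.
elim/big_ind2: _ => [|x1 x2 y1 y2 h1 h2|//]; first by rewrite enorm0.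
exact: le_trans (enormD _ _) (lerD h1 h2).
Qed.

Lemma sqr_sum_le (K : realType) (s : nat) (t : 'I_s -> K) :
  (\sum_(i < s) t i) ^+ 2 <= s%:R * \sum_(i < s) t i ^+ 2.
Proof.
pose u : 'rV[K]_s := const_mx 1; pose v : 'rV[K]_s := \row_i t i.
have e1 : dotp u v = \sum_i t i by apply: eq_bigr => i _; rewrite !mxE mul1r.
have e2 : dotp v v = \sum_i t i ^+ 2 by apply: eq_bigr => i _; rewrite !mxE expr2.
have e3 : dotp u u = s%:R.
  rewrite /dotp (eq_bigr (fun=> 1)) => [|i _]; last by rewrite !mxE mul1r.
  by rewrite sumr_const card_ord.
rewrite -e1 -e2 -e3 -!enorm_sqr -exprMn -[leLHS]real_normK ?num_real //.
rewrite ler_pXn2r ?nnegrE ?mulr_ge0 ?enorm_ge0 // ler_norml cauchy_schwarz.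
by rewrite lerNl -dotpNl (le_trans (cauchy_schwarz _ _)) // enormN.
Qed.

Lemma enorm_sqrB (K : realType) (n : nat) (u v : 'rV[K]_n) :
  enorm (u - v) ^+ 2 = enorm u ^+ 2 - 2 * dotp u v + enorm v ^+ 2.
Proof.
have e := enorm_sqr.
by rewrite (e _ _ (u - v)) (e _ _ u) (e _ _ v) !dotpE (dotpC v u); ring.
Qed.

Lemma dotpBr (K : realType) (n : nat) (u v w : 'rV[K]_n) :
  dotp u (v - w) = dotp u v - dotp u w.
Proof. by rewrite dotpDr dotpNr. Qed.

Lemma normr_le_enorm (K : realType) (n : nat) (u : 'rV[K]_n) : `|u| <= enorm u.
Proof.
rewrite [leLHS]/Num.Def.normr /= mx_normrE bigmax_le ?enorm_ge0 // => -[i j] _ /=.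
by rewrite ord1 coord_le_enorm.
Qed.

Lemma enorm_le_normr (K : realType) (n : nat) (u : 'rV[K]_n) :
  enorm u <= n.+1%:R * `|u|.
Proof.
rewrite -(ler_pXn2r (n := 2)) ?nnegrE ?mulr_ge0 ?enorm_ge0 //.
rewrite enorm_sqr exprMn (@le_trans _ _ (\sum_(i < n) `|u| ^+ 2)) //.
  apply: ler_sum => i _; rewrite -expr2 -[leLHS]real_normK ?num_real //.
  rewrite ler_pXn2r ?nnegrE //.
  by rewrite [leRHS]/Num.Def.normr /= mx_normrE; apply/bigmax_geP; right; exists (0, i).
rewrite sumr_const card_ord -[leLHS]mulr_natl ler_wpM2r ?sqr_ge0 //.
by rewrite -natrX ler_nat (leq_trans (leqnSn n)) // expnS leq_pmulr // expn1.
Qed.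

Lemma nbhs_enormP (K : realType) (n : nat) (x : 'rV[K]_n) (U : set 'rV[K]_n) :
  nbhs x U <-> exists2 r, 0 < r & forall y, enorm (y - x) < r -> U y.
Proof.
split=> [/nbhs_ballP[r r0 rU]|[r r0 rU]].
  exists r => // y yr; apply: rU; rewrite -ball_normE /ball_ /=.
  by rewrite distrC (le_lt_trans (normr_le_enorm _)).
apply/nbhs_ballP; exists (r / n.+1%:R) => /=; first by rewrite divr_gt0.
move=> y; rewrite -ball_normE /ball_ /= distrC => xy; apply: rU.
by rewrite (le_lt_trans (enorm_le_normr _)) // mulrC -ltr_pdivlMr.
Qed.

Lemma cvg_enormP (K : realType) (n : nat) (x : nat -> 'rV[K]_n) (l : 'rV[K]_n) :
  x @ \oo --> l <->
  forall e, 0 < e -> exists N, forall k, (N <= k)%N -> enorm (x k - l) < e.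
Proof.
split=> [xl e e0|xl].
  have [|N _ hN] := xl [set y | enorm (y - l) < e].
    by apply/nbhs_enormP; exists e.
  by exists N => k Nk; apply: hN.
move=> U /nbhs_enormP[r r0 rU]; have [N hN] := xl r r0.
by exists N => // k Nk; apply: rU; exact: hN.
Qed.

Lemma diff_gradE (K : realType) (n : nat) (F : 'rV[K]_n -> K) x v :
  differentiable F x -> 'd F x v = dotp (grad F x) v.
Proof.
move=> dF; rewrite {1}(row_sum_delta v) linear_sum; apply: eq_bigr => i _.
by rewrite linearZ /= mxE mulrC.
Qed.

Lemma derive_along_line (K : realType) (n : nat) (F : 'rV[K]_n -> K)
    (x v : 'rV[K]_n) (t : K) :
  differentiable F (x + t *: v) ->
  is_derive t 1 (fun t => F (x + t *: v)) (dotp (grad F (x + t *: v)) v).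
Proof.
move=> dF.
pose g := cst x + *:%R^~ v.
have dg : is_diff t (g : K -> _) (0 + *:%R^~ v) by apply: is_diffD.
have dG : differentiable g t by [].
have dFg : differentiable (F \o g) t by apply: differentiable_comp.
apply: DeriveDef; first exact: diff_derivable.
rewrite deriveE // diff_comp //=.
rewrite (@diff_val _ _ _ _ _ g _ dg) /=.
by rewrite add0r scale1r diff_gradE.
Qed.

Lemma descent_lemma (K : realType) (n : nat) (F : 'rV[K]_n -> K) (L : K)
    (x y : 'rV[K]_n) :
  (forall x, differentiable F x) -> elipschitz L (grad F) ->
  `|F y - F x - dotp (grad F x) (y - x)| <= L / 2 * enorm (y - x) ^+ 2.
Proof.
move=> dF LF; set v := y - x; set A := dotp _ v; set B := L / 2 * _.
suff key (e : K) : `|e| = 1 -> e * (F y - F x - A) <= B.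
  rewrite ler_norml lerNl -mulN1r key ?normrN1 //=.
  by rewrite -[leLHS]mul1r key ?normr1.
move=> e1.
pose h (t : K) := e * (F (x + t *: v) - t * A) - t ^+ 2 * B.
pose dh (t : K) := e * (dotp (grad F (x + t *: v)) v - A) - 2 * t * B.
have hD (t : K) : is_derive t 1 h (dh t).
  have D1 := derive_along_line (dF (x + t *: v)).
  have D2 : is_derive t 1 (fun t : K => t * A) A.
    by apply: is_derive_eq; rewrite ?mulr1 /GRing.scale /=; ring.
  have D3 : is_derive t 1 (fun t : K => t ^+ 2 * B) (2 * t * B).
    by apply: is_derive_eq; rewrite /GRing.scale /=; ring.
  by apply: is_derive_eq; rewrite /GRing.scale /= /dh; ring.
have [|c /[!in_itv]/= /andP[c0 c1]] := @MVT_segment _ h dh 0 1 ler01 (fun t _ => hD t).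
  by apply: derivable_within_continuous => t _; exact: ex_derive.
rewrite /h scale1r scale0r addr0 /v [x + _]addrC subrK -/v => E.
suff : dh c <= 0 by move: E; lra.
rewrite /dh /A -dotpNl -dotpDl -dotpZl subr_le0.
apply: le_trans (cauchy_schwarz _ _) _.
rewrite enormZ e1 mul1r /B.
have := LF (x + c *: v) x.
rewrite [x + _]addrC addrK enormZ ger0_norm // => h1.
have := ler_wpM2r (enorm_ge0 v) h1.
by lra.
Qed.

(** * Subgradients and desingularizing functions *)

Lemma quadratic_minorant_frechet_subdiff (K : realType) (n : nat)
    (J : 'rV[K]_n -> \bar K) (x v : 'rV[K]_n) (C : K) :
  J x \is a fin_num -> 0 <= C ->
  (forall z, ((fine (J x) + dotp v (z - x) - C * enorm (z - x) ^+ 2)%:E <= J z)%E) ->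
  frechet_subdiff J x v.
Proof.
move=> Jx C0 minor; split; first by rewrite /edom /= ltey_eq Jx.
rewrite oppe_ge0; apply/lee_addgt0Pr => e e0; rewrite add0e.
apply: ge_ereal_inf; exists (ereal_sup [set (- ((enorm (x - z))^-1%:E *
   (J z - J x - (dotp v (z - x))%:E)))%E | z in
   [set z | enorm (z - x) < e / (C + 1)]]).
  exists [set z | enorm (z - x) < e / (C + 1)] => //.
  apply: nbhs_dnbhs; apply/nbhs_enormP; exists (e / (C + 1)) => //.
  by rewrite divr_gt0 // ltr_wpDl.
apply: ge_ereal_sup => _ [z /= zx <-].
rewrite leeNl.
have h : ((- (C * enorm (z - x) ^+ 2))%:E <= J z - J x - (dotp v (z - x))%:E)%E.
  have := minor z; rewrite -{2}(fineK Jx).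
  case: (J z) => [r| |] /=; last 2 first.
  - by move=> _; rewrite !addye // leey.
  - by rewrite leeNy_eq.
  by rewrite -!EFinD !lee_fin; lra.
have inv0 : (0 <= (enorm (x - z))^-1%:E)%E by rewrite lee_fin invr_ge0 enorm_ge0.
apply: le_trans (lee_wpmul2l inv0 h).
rewrite -EFinM lee_fin enormB; set d := enorm _ in zx *.
have d0 : 0 <= d by exact: enorm_ge0.
have [->|dn0] := eqVneq d 0; first by rewrite expr0n mulr0 oppr0 mulr0 oppr_le0 ltW.
have -> : d^-1 * - (C * d ^+ 2) = - (C * d) by field.
rewrite lerN2; apply: (@le_trans _ _ ((C + 1) * d)); first by nra.
by rewrite mulrC -ler_pdivlMr ?ltW // ltr_wpDl.
Qed.

Lemma frechet_subdiff_subdiff (K : realType) (n : nat)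
    (J : 'rV[K]_n -> \bar K) (x : 'rV[K]_n) :
  frechet_subdiff J x `<=` subdiff J x.
Proof.
move=> v Jv; split; first by case: Jv.
by exists (fun=> x), (fun=> v); split => //; exact: cvg_cst.
Qed.

Lemma edistance_le (K : realType) (n : nat) (x v : 'rV[K]_n) (A : set 'rV[K]_n) :
  A v -> (edistance x A <= (enorm (x - v))%:E)%E.
Proof. by move=> Av; apply: ereal_inf_lbound; exists v. Qed.

Lemma desingularizing_tangent (K : realType) (eta : \bar K) (phi : K -> K) (t u : K) :
  desingularizing eta phi ->
  0 < t -> (t%:E < eta)%E -> 0 <= u -> (u%:E < eta)%E ->
  phi u - phi t <= derive1 phi t * (u - t).
Proof.
move=> [_ _ cvx _ dphi] t0 teta u0 ueta.
have [phi'P _ _] := dphi t (conj t0 teta).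
have [->|ut] := eqVneq u t; first by rewrite !subrr mulr0.
apply/ler_addgt0Pr => e e0.
have c : (fun h => h^-1 *: (phi (h + t) - phi t)) @ 0^' --> derive1 phi t.
  move: phi'P; rewrite /derivable /derive1 => c.
  suff E : (fun h : K => h^-1 *: ((phi \o shift t) (h *: (1 : K)) - phi t)) =
    (fun h => h^-1 *: (phi (h + t) - phi t)) by rewrite E in c.
  by apply/funext => h /=; rewrite [h *: 1]mulr1.
have ep : 0 < e / `|u - t| by rewrite divr_gt0 // normr_gt0 subr_eq0.
have /cvgrPdist_lt /(_ _ ep) := c.
case/nbhs_ballP => d /= d0 hd.
pose lam := Num.min 1 (d / (2 * `|u - t|)).
have un0 : 0 < `|u - t| by rewrite normr_gt0 subr_eq0.
have lam0 : 0 < lam by rewrite lt_min ltr01 /= divr_gt0 // mulr_gt0.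
have lam1 : lam <= 1 by rewrite ge_min lexx.
have lamd : lam * `|u - t| < d.
  have : lam <= d / (2 * `|u - t|) by rewrite ge_min lexx orbT.
  rewrite ler_pdivlMr ?mulr_gt0 // => h; by lra.
have hne : lam * (u - t) != 0 by rewrite mulf_eq0 negb_or (gt_eqF lam0) subr_eq0.
have := hd (lam * (u - t)); rewrite /ball /= sub0r normrN normrM (gtr0_norm lam0).
move=> /(_ lamd hne); set h := lam * (u - t); rewrite distrC => hq.
have := cvx (Itv01 (ltW lam0) lam1) u t.
rewrite !inE => /(_ (conj u0 ueta) (conj (ltW t0) teta)).
rewrite convRE /conv /= /unstable.onem.
have -> : lam *: u + (1 - lam) *: t = h + t.
  by rewrite /h /GRing.scale /=; ring.
set A := phi (h + t) in hq * => cA.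
have hA : h^-1 *: (A - phi t) * h = A - phi t.
  by rewrite /GRing.scale /= mulrAC mulVf ?mul1r.
set q := h^-1 *: (A - phi t) in hA hq.
have : lam * (phi u - phi t) <= q * h by rewrite hA; lra.
rewrite /h mulrCA ler_pM2l // => cq.
have : (q - derive1 phi t) * (u - t) <= e.
  apply: le_trans (ler_norm _) _; rewrite normrM -ler_pdivlMr //.
  exact: ltW.
by lra.
Qed.

Lemma desingularizing_small (K : realType) (eta : \bar K) (phi : K -> K) (e : K) :
  desingularizing eta phi -> (0 < eta)%E -> 0 < e ->
  exists2 d, 0 < d & forall t, 0 <= t < d -> (t%:E < eta)%E -> phi t < e.
Proof.
move=> [_ phic _ phi0 _] eta0 e0.
have /subspace_continuousP/(_ 0 (conj (lexx 0) eta0)) := phic.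
move=> /=; rewrite /from_subspace phi0 => /cvgrPdist_lt /(_ e e0) /nbhs_ballP[d /= d0 hd].
exists d => // t /andP[t0 td] teta.
have /= := hd t; rewrite /ball /= !sub0r !normrN (ger0_norm t0) => /(_ td (conj t0 teta)).
by apply: le_lt_trans; exact: ler_norm.
Qed.

Lemma desingularizing_derive1_le (K : realType) (eta : \bar K) (phi : K -> K) (t u : K) :
  desingularizing eta phi -> 0 < t -> t <= u -> (u%:E < eta)%E ->
  derive1 phi u <= derive1 phi t.
Proof.
move=> dphi t0 tu ueta.
have [<-//|ne] := eqVneq t u.
have teta : (t%:E < eta)%E by apply: le_lt_trans ueta; rewrite lee_fin.
have u0 : 0 < u by exact: lt_le_trans tu.
have h1 := desingularizing_tangent dphi t0 teta (ltW u0) ueta.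
have h2 := desingularizing_tangent dphi u0 ueta (ltW t0) teta.
have : 0 <= (u - t) * (derive1 phi t - derive1 phi u) by lra.
by rewrite pmulr_rge0 ?subr_ge0 // subr_gt0 lt_neqAle ne.
Qed.

(* Desingularizes [H = h + W], with [h] the gap of [Phi] and [W] a sum of squared
   steps: if [H <= 2 h] the derivative of [phi] at [H / 2] is at least the one
   at [h], otherwise [H <= 2 W] and the square root bounds [H] by the steps. *)
Definition lyap_desing (K : realType) (phi : K -> K) (t : K) : K :=
  2 * phi (t / 2) + 2 * Num.sqrt t.

Lemma lyap_desing_ge0 (K : realType) (eta : \bar K) (phi : K -> K) (t : K) :
  desingularizing eta phi -> 0 <= t -> (t%:E < eta)%E -> 0 <= lyap_desing phi t.
Proof.
move=> [phi_ge0 _ _ _ _] t0 teta; rewrite addr_ge0 ?mulr_ge0 ?sqrtr_ge0 //.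
apply: phi_ge0; split; first by rewrite divr_ge0.
by apply: le_lt_trans teta; rewrite lee_fin ler_pdivrMr // ler_peMr // ler1n.
Qed.

Lemma lyap_desing_small (K : realType) (eta : \bar K) (phi : K -> K) (e : K) :
  desingularizing eta phi -> (0 < eta)%E -> 0 < e ->
  exists2 d, 0 < d &
    forall t, 0 <= t < d -> (t%:E < eta)%E -> lyap_desing phi t < e.
Proof.
move=> dphi eta0 e0.
have [d d0 hd] := desingularizing_small dphi eta0 (divr_gt0 e0 (ltr0n _ 4)).
exists (Num.min d ((e / 4) ^+ 2)); first by rewrite lt_min d0 exprn_gt0 ?divr_gt0.
move=> t /andP[t0]; rewrite lt_min => /andP[td te] teta.
have : phi (t / 2) < e / 4.
  have h : t / 2 <= t by rewrite ler_pdivrMr // ler_peMr // ler1n.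
  apply: hd; first by rewrite divr_ge0 //= (le_lt_trans h).
  by apply: le_lt_trans teta; rewrite lee_fin.
have : Num.sqrt t < e / 4.
  by rewrite -(ltr_pXn2r (n := 2)) ?nnegrE ?sqrtr_ge0 ?divr_ge0 ?(ltW e0) // sqr_sqrtr.
by rewrite /lyap_desing; lra.
Qed.

Lemma lyap_desing_tangent (K : realType) (eta : \bar K) (phi : K -> K) (t u : K) :
  desingularizing eta phi -> 0 < t -> (t%:E < eta)%E -> 0 <= u <= t ->
  (derive1 phi (t / 2) + (Num.sqrt t)^-1) * (t - u) <=
  lyap_desing phi t - lyap_desing phi u.
Proof.
move=> dphi t0 teta /andP[u0 ut].
have half (r : K) : 0 <= r -> r / 2 <= r.
  by move=> r0; rewrite ler_pdivrMr // ler_peMr // ler1n.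
have lt_eta (r : K) : 0 <= r <= t -> ((r / 2)%:E < eta)%E.
  move=> /andP[r0 rt]; apply: le_lt_trans teta; rewrite lee_fin.
  exact: le_trans (half r r0) rt.
have h := @desingularizing_tangent _ _ _ (t / 2) (u / 2) dphi.
have {}h : phi (u / 2) - phi (t / 2) <= derive1 phi (t / 2) * (u / 2 - t / 2).
  by apply: h; rewrite ?divr_gt0 ?divr_ge0 ?lt_eta ?u0 ?(ltW t0) //=.
rewrite /lyap_desing; set a := Num.sqrt t; set b := Num.sqrt u.
have a0 : 0 < a by rewrite sqrtr_gt0.
have b0 : 0 <= b by exact: sqrtr_ge0.
have ba : b <= a by rewrite ler_wsqrtr.
have hs : a^-1 * (t - u) <= 2 * (a - b).
  rewrite -(sqr_sqrtr (ltW t0)) -(sqr_sqrtr u0) -/a -/b.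
  by rewrite ler_pdivrMl //; nra.
by lra.
Qed.

Lemma le_of_sqr_le (K : realType) (d S p q kap del dH dpsi : K) :
  0 < q -> 0 < del -> 0 <= kap -> 0 <= S -> 0 <= dH ->
  del * d ^+ 2 <= dH -> 1 <= kap * S * p -> p * dH <= dpsi ->
  d <= q * S + kap / (4 * q * del) * dpsi.
Proof.
move=> q0 del0 kap0 S0 dH0 dd kSp pdH.
have kS0 : 0 <= kap * S by rewrite mulr_ge0.
have dHle : dH <= kap * S * dpsi.
  apply: (@le_trans _ _ (kap * S * (p * dH))); last by rewrite ler_wpM2l.
  by rewrite mulrA ler_peMl.
have dpsi0 : 0 <= dpsi.
  have p0 : 0 <= p by rewrite leNgt; apply/negP => p0; have := mulr_ge0_le0 kS0 (ltW p0); lra.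
  by apply: le_trans pdH; rewrite mulr_ge0.
set B := kap / _ * _.
have B0 : 0 <= B by rewrite mulr_ge0 ?divr_ge0 ?mulr_ge0 // ltW.
have BE : 4 * q * del * B = kap * dpsi.
  by rewrite /B; field; rewrite !gt_eqF.
rewrite leNgt; apply/negP => lt.
have qS0 : 0 <= q * S by rewrite mulr_ge0 // ltW.
have lt2 : (q * S + B) ^+ 2 < d ^+ 2 by rewrite ltr_pXn2r ?nnegrE //; lra.
have := ltr_pM2l del0 ((q * S + B) ^+ 2) (d ^+ 2); rewrite lt2 => /idP lt3.
have := mulr_ge0 (ltW del0) (sqr_ge0 (q * S - B)).
have : 4 * q * del * B * S = kap * dpsi * S by rewrite BE.
by lra.
Qed.

Lemma kl_step (K : realType) (eta : \bar K) (phi : K -> K)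
    (h W H H' d S q del sig c : K) :
  desingularizing eta phi -> 0 < q -> 0 < del -> 0 <= sig -> 0 <= c -> 0 <= S ->
  H = h + W -> 0 <= W <= c * S ^+ 2 ->
  0 <= H' -> (H%:E < eta)%E -> H' + del * d ^+ 2 <= H ->
  (0 < h -> (h%:E < eta)%E -> 1 <= derive1 phi h * (sig * S)) ->
  d <= q * S + (sig + 1 + 2 * c) / (4 * q * del) *
                 (lyap_desing phi H - lyap_desing phi H').
Proof.
move=> dphi q0 del0 sig0 c0 S0 HE /andP[W0 Wc] H'0 Heta desc kl.
have dd0 : 0 <= del * d ^+ 2 by rewrite mulr_ge0 ?sqr_ge0 // ltW.
have H0 : 0 <= H by lra.
have [He|Hne] := eqVneq H 0.
  have H'e : H' = 0 by lra.
  have : del * d ^+ 2 = 0 by lra.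
  move/eqP; rewrite mulf_eq0 gt_eqF //= sqrf_eq0 => /eqP ->.
  by rewrite He H'e subrr mulr0 addr0 mulr_ge0 // ltW.
have Hp : 0 < H by rewrite lt_def Hne.
have H'H : 0 <= H' <= H by rewrite H'0 /=; lra.
have dH : 0 <= H - H' by lra.
have desc' : del * d ^+ 2 <= H - H' by lra.
have kap0 : 0 <= sig + 1 + 2 * c by lra.
apply: (le_of_sqr_le q0 del0 kap0 S0 dH desc' _ (lyap_desing_tangent dphi Hp Heta H'H)).
have sH : 0 < Num.sqrt H by rewrite sqrtr_gt0.
have isH : 0 < (Num.sqrt H)^-1 by rewrite invr_gt0.
have H2 : 0 < H / 2 by rewrite divr_gt0.
have H2eta : ((H / 2)%:E < eta)%E.
  by apply: le_lt_trans Heta; rewrite lee_fin; lra.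
have phi'0 : 0 < derive1 phi (H / 2).
  by case: dphi => _ _ _ _ dphi; have [] := dphi _ (conj H2 H2eta).
have kS : 0 <= (sig + 1 + 2 * c) * S by rewrite mulr_ge0.
have [hH|hH] := leP H (2 * h).
  have hp : 0 < h by lra.
  have heta : (h%:E < eta)%E by apply: le_lt_trans Heta; rewrite lee_fin; lra.
  apply: le_trans (kl hp heta) _.
  have le1 : derive1 phi h <= derive1 phi (H / 2).
    by apply: (desingularizing_derive1_le dphi _ _ heta) => //; lra.
  have le2 : derive1 phi h * (sig * S) <= derive1 phi (H / 2) * (sig * S).
    by rewrite ler_wpM2r ?mulr_ge0.
  apply: le_trans le2 _; rewrite mulrC ler_pM ?mulr_ge0 ?(ltW phi'0) //; last by lra.
  by rewrite ler_wpM2r //; lra.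
have sHS : Num.sqrt H <= (sig + 1 + 2 * c) * S.
  rewrite -(ler_pXn2r (n := 2)) ?nnegrE ?(ltW sH) // sqr_sqrtr // exprMn.
  have : H <= 2 * c * S ^+ 2 by lra.
  move=> HS; apply: le_trans HS _; rewrite ler_wpM2r ?sqr_ge0 //.
  by rewrite expr2 (@le_trans _ _ (sig + 1 + 2 * c)) // ?ler_peMr //; lra.
rewrite mulrDr -[leLHS]add0r lerD // ?mulr_ge0 ?(ltW phi'0) //.
by rewrite -ler_pdivrMr ?invr_gt0 // invrK mul1r.
Qed.

(** * Limits, step-size conditions and the proximal step *)

Lemma limn_esup_lt_near (K : realType) (u : nat -> \bar K) (c : \bar K) :
  (limn_esup u < c)%E -> \forall k \near \oo, (u k < c)%E.
Proof.
move=> /ereal_inf_lt[_ [V Voo <-] Vc]; apply: filterS Voo => k Vk.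
by apply: le_lt_trans Vc; apply: ereal_sup_ubound; exists k.
Qed.

Lemma limn_einf_gt_near (K : realType) (u : nat -> \bar K) (c : \bar K) :
  (c < limn_einf u)%E -> \forall k \near \oo, (c < u k)%E.
Proof.
rewrite /limn_einf lteNr => /limn_esup_lt_near; apply: filterS => k.
by rewrite lteN2.
Qed.

Lemma limn_esup_fin_num (K : realType) (u : nat -> K) (M : K) :
  (forall k, 0 <= u k <= M) -> limn_esup (fun k => (u k)%:E) \is a fin_num.
Proof.
move=> uM; rewrite ge0_fin_numE; last first.
  apply: limf_esup_ge0 => [|k]; first by case=> N _ /(_ N (leqnn N)).
  by rewrite lee_fin; case/andP: (uM k).
apply: le_lt_trans (ltry M); apply: ge_ereal_inf.
exists (ereal_sup [set (u k)%:E | k in setT]); first by exists setT => //; exact: filterT.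
by apply: ge_ereal_sup => _ [k _ <-]; rewrite lee_fin; case/andP: (uM k).
Qed.

Lemma MiFB_delta_eventually (K : realType) (s : nat) (L mu nu : K)
    (gamma : nat -> K) (a b : 'I_s -> nat -> K) (gamma_lo : K) :
  (0 < s)%N -> 0 < gamma_lo -> 0 < mu -> 0 < nu ->
  (forall k, gamma_lo <= gamma k) ->
  (forall i k, `|a i k| <= 2) -> (forall i k, `|b i k| <= 2) ->
  (0 < MiFB_delta L mu nu gamma a b)%E ->
  exists (al : 'I_s -> K) (be : K) (N : nat),
    [/\ forall i, 0 <= al i, \sum_(i < s) al i < be,
        forall k, (N <= k)%N -> be <= MiFB_beta L mu nu gamma k &
        forall k, (N <= k)%N -> forall i, MiFB_alpha L mu nu gamma a b k i <= al i].
Proof.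
move=> s0 glo0 mu0 nu0 glo a2 b2.
pose M := s%:R * 4 / (2 * gamma_lo * mu) + s%:R * 4 * L ^+ 2 / (2 * nu).
have g0 k : 0 < gamma k by exact: lt_le_trans (glo k).
have sq4 (t : K) : `|t| <= 2 -> t ^+ 2 <= 4.
  move=> t2; rewrite -[leLHS]real_normK ?num_real //.
  by have := normr_ge0 t; nra.
have al0 k i : 0 <= MiFB_alpha L mu nu gamma a b k i.
  apply: addr_ge0; apply: divr_ge0.
  - by rewrite mulr_ge0 ?sqr_ge0.
  - by rewrite ltW // !mulr_gt0.
  - by rewrite mulr_ge0 ?sqr_ge0 // mulr_ge0 ?sqr_ge0.
  - by rewrite ltW // mulr_gt0.
have alM k i : 0 <= MiFB_alpha L mu nu gamma a b k i <= M.
  rewrite al0 /= lerD //.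
    apply: ler_pM.
    - by rewrite mulr_ge0 ?sqr_ge0.
    - by rewrite invr_ge0 ltW // !mulr_gt0.
    - by rewrite ler_wpM2l // sq4.
    - rewrite lef_pV2 ?posrE ?mulr_gt0 // ler_wpM2r ?(ltW mu0) //.
      by rewrite ler_wpM2l.
  rewrite ler_wpM2r ?invr_ge0 ?mulr_ge0 ?(ltW nu0) // ler_wpM2r ?sqr_ge0 //.
  by rewrite ler_wpM2l // sq4.
have fin i := limn_esup_fin_num (fun k => alM k i).
pose A i := fine (limn_esup (fun k => (MiFB_alpha L mu nu gamma a b k i)%:E)).
have AE i : limn_esup (fun k => (MiFB_alpha L mu nu gamma a b k i)%:E) = (A i)%:E.
  by rewrite fineK.
have A0 i : 0 <= A i.
  rewrite -lee_fin -AE; apply: limf_esup_ge0 => [|k].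
    by case=> N _ /(_ N (leqnn N)).
  by rewrite lee_fin.
rewrite /MiFB_delta (eq_bigr _ (fun i _ => AE i)) sumEFin sube_gt0.
set SA := \sum_i A i => SAlt.
have [be [SAbe belt]] : exists be : K, SA < be /\
    (be%:E < limn_einf (fun k => (MiFB_beta L mu nu gamma k)%:E))%E.
  move: SAlt; case: limn_einf => [r| |] //=.
    by rewrite lte_fin => h; exists ((SA + r) / 2); rewrite lte_fin; lra.
  by move=> _; exists (SA + 1); rewrite ltry; lra.
pose e := (be - SA) / (2 * s%:R).
have sR : 0 < s%:R :> K by rewrite ltr0n.
have e0 : 0 < e by rewrite divr_gt0 ?mulr_gt0 // subr_gt0.
have sumal : \sum_(i < s) (A i + e) < be.
  rewrite big_split /= -/SA sumr_const card_ord -mulr_natl /e.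
  have -> : s%:R * ((be - SA) / (2 * s%:R)) = (be - SA) / 2.
    by field; rewrite gt_eqF.
  by lra.
have [N1 _ hN1] := limn_einf_gt_near belt.
have : \forall k \near \oo, forall i,
    ((MiFB_alpha L mu nu gamma a b k i)%:E < (A i + e)%:E)%E.
  apply: filter_forall => i.
  by apply: (@limn_esup_lt_near _ (fun k => (MiFB_alpha L mu nu gamma a b k i)%:E));
    rewrite AE lte_fin ltrDl.
case=> N2 _ hN2.
exists (fun i => A i + e), be, (maxn N1 N2); split => //.
- by move=> i; rewrite addr_ge0 // ltW.
- by move=> k; rewrite geq_max => /andP[h _]; have := hN1 k h; rewrite lte_fin => /ltW.
- move=> k; rewrite geq_max => /andP[_ h] i.
  by have := hN2 k h i; rewrite lte_fin => /ltW.
Qed.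

Lemma prox_fin_num (K : realType) (n : nat) (R : 'rV[K]_n -> \bar K) (g : K)
    (z p : 'rV[K]_n) :
  eproper R -> 0 < g -> prox g R z p -> R p \is a fin_num.
Proof.
move=> [RNy [q Rq]] g0 /(_ q) h.
have Rqfin : R q \is a fin_num by rewrite fin_numE gt_eqF ?RNy //= lt_eqF.
rewrite fin_numE gt_eqF ?RNy //=; apply/negP => /eqP Rp.
move: h; rewrite Rp gt0_muley ?lte_fin // addey // leye_eq.
by rewrite -(fineK Rqfin) -EFinM -EFinD.
Qed.

Lemma prox_forward_le (K : realType) (n : nat) (R : 'rV[K]_n -> \bar K) (g : K)
    (ya v p y : 'rV[K]_n) :
  eproper R -> 0 < g -> prox g R (ya - g *: v) p -> R y \is a fin_num ->
  2^-1 * enorm (p - ya) ^+ 2 + g * dotp v (p - ya) + g * fine (R p) <=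
  2^-1 * enorm (y - ya) ^+ 2 + g * dotp v (y - ya) + g * fine (R y).
Proof.
move=> Rproper g0 pp Ry; have Rp := prox_fin_num Rproper g0 pp.
have := pp y; rewrite /= -(fineK Ry) -(fineK Rp) -!EFinM -!EFinD lee_fin /=.
have E (w : 'rV[K]_n) : enorm (w - (ya - g *: v)) ^+ 2 =
    enorm (w - ya) ^+ 2 + 2 * g * dotp v (w - ya) + g ^+ 2 * enorm v ^+ 2.
  rewrite opprB addrCA addrC !enorm_sqr !dotpE (dotpC _ v).
  by rewrite (dotpC ya v) (dotpC w ya); ring.
by rewrite !E; lra.
Qed.

Section ForwardBackwardStep.
Variables (K : realType) (n : nat) (R : 'rV[K]_n -> \bar K) (F : 'rV[K]_n -> K).
Variables (G : 'rV[K]_n -> 'rV[K]_n).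
Variables (L g : K) (x ya yb p : 'rV[K]_n).
Hypothesis R_proper : eproper R.
Hypothesis L_gt0 : 0 < L.
Hypothesis F_lip : elipschitz L G.
Hypothesis F_quad : forall x y,
  `|F y - F x - dotp (G x) (y - x)| <= L / 2 * enorm (y - x) ^+ 2.
Hypothesis g_gt0 : 0 < g.
Hypothesis p_prox : prox g R (ya - g *: G yb) p.

Let Phi x := (R x + (F x)%:E)%E.

Lemma forward_backward_fin_num : Phi p \is a fin_num.
Proof. by rewrite fin_numD (prox_fin_num R_proper g_gt0 p_prox). Qed.

Lemma fine_Phi y : Phi y \is a fin_num ->
  R y \is a fin_num /\ fine (Phi y) = fine (R y) + F y.
Proof. by rewrite fin_numD => /andP[Ry _]; split=> //; rewrite fineD. Qed.

Lemma forward_backward_descent (mu nu : K) : 0 < mu -> 0 < nu ->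
  Phi x \is a fin_num ->
  fine (Phi p) + (1 - g * L - mu - nu * g) / (2 * g) * enorm (p - x) ^+ 2 <=
  fine (Phi x) + enorm (ya - x) ^+ 2 / (2 * g * mu) +
  L ^+ 2 * enorm (yb - x) ^+ 2 / (2 * nu).
Proof.
move=> mu0 nu0 /fine_Phi[Rx ->]; have [Rp ->] := fine_Phi forward_backward_fin_num.
have := prox_forward_le R_proper g_gt0 p_prox Rx.
have -> : p - ya = (p - x) - (ya - x) by rewrite opprB addrA subrK.
have := F_quad x p; rewrite ler_norml => /andP[_].
have -> : x - ya = - (ya - x) by rewrite opprB.
have wlip := F_lip x yb; rewrite enormB in wlip; rewrite [enorm (x - yb)]enormB in wlip.
set d := p - x; set u := ya - x; set w := yb - x in wlip *; clearbody d u w.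
rewrite (enormN u) (enorm_sqrB d u) (dotpBr (G yb) d u) (dotpNr (G yb) u).
move=> Fp prx.
have Y1 := young d u mu0.
have Y2 := young d (G x - G yb) nu0.
have w2 : enorm (G x - G yb) ^+ 2 <= L ^+ 2 * enorm w ^+ 2.
  by rewrite -exprMn ler_pXn2r ?nnegrE ?mulr_ge0 ?enorm_ge0 ?(ltW L_gt0) // enormB.
have {w2} := ler_wpM2r (_ : 0 <= (2 * nu)^-1) w2.
rewrite invr_ge0 mulr_ge0 ?(ltW nu0) // => /(_ isT) w2.
move: Y2; rewrite (dotpBr d (G x) (G yb)) (dotpC d (G x)) (dotpC d (G yb)) => Y2.
rewrite -(ler_pM2l g_gt0).
have -> : g * (fine (R p) + F p + (1 - g * L - mu - nu * g) / (2 * g) * enorm d ^+ 2) =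
  g * fine (R p) + g * F p + (1 - g * L - mu - nu * g) / 2 * enorm d ^+ 2.
  by field; rewrite gt_eqF.
have -> : g * (fine (R x) + F x + enorm u ^+ 2 / (2 * g * mu) +
    L ^+ 2 * enorm w ^+ 2 / (2 * nu)) =
  g * fine (R x) + g * F x + enorm u ^+ 2 / (2 * mu) +
    g * (L ^+ 2 * enorm w ^+ 2 / (2 * nu)).
  by field; rewrite !gt_eqF.
have : g * (F p - F x - dotp (G x) d) <= g * (L / 2 * enorm d ^+ 2).
  by rewrite ler_pM2l.
have : g * (dotp (G x) d - dotp (G yb) d) <=
    g * (nu / 2 * enorm d ^+ 2 + L ^+ 2 * enorm w ^+ 2 / (2 * nu)).
  by rewrite ler_pM2l //; lra.
by lra.
Qed.

Lemma forward_backward_competitor :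
  Phi x \is a fin_num ->
  g * fine (Phi p) + 2^-1 * enorm (p - ya) ^+ 2 - g * L / 2 * enorm (p - yb) ^+ 2 <=
  g * fine (Phi x) + 2^-1 * enorm (x - ya) ^+ 2 + g * L / 2 * enorm (x - yb) ^+ 2.
Proof.
move=> /fine_Phi[Rx ->]; have [Rp ->] := fine_Phi forward_backward_fin_num.
have := prox_forward_le R_proper g_gt0 p_prox Rx.
have := F_quad yb p; rewrite ler_norml => /andP[_ Fp].
have := F_quad yb x; rewrite ler_norml => /andP[Fx _].
have Fp' : g * (F p - F yb - dotp (G yb) (p - yb)) <=
   g * (L / 2 * enorm (p - yb) ^+ 2) by rewrite ler_pM2l.
have Fx' : g * - (L / 2 * enorm (x - yb) ^+ 2) <=
   g * (F x - F yb - dotp (G yb) (x - yb)) by rewrite ler_pM2l.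
move: Fp' Fx'; rewrite (dotpBr (G yb) p ya) (dotpBr (G yb) p yb).
by rewrite (dotpBr (G yb) x ya) (dotpBr (G yb) x yb); lra.
Qed.

Definition forward_backward_subgradient : 'rV[K]_n :=
  g^-1 *: (ya - p) - G yb + G p.

Lemma forward_backward_subgradientP : frechet_subdiff Phi p forward_backward_subgradient.
Proof.
have Pp := forward_backward_fin_num; have [Rp PpE] := fine_Phi Pp.
apply: (@quadratic_minorant_frechet_subdiff _ _ _ _ _ ((2 * g)^-1 + L / 2)) => //.
  by rewrite addr_ge0 ?invr_ge0 ?divr_ge0 ?mulr_ge0 // ltW.
move=> z; have [Rz|] := boolP (R z \is a fin_num); last first.
  rewrite fin_numE gt_eqF ?(proj1 R_proper) //= negbK => /eqP Rz.
  by rewrite /Phi Rz addye // leey.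
have Pz : Phi z \is a fin_num by rewrite fin_numD Rz.
rewrite -(fineK Pz) lee_fin PpE (proj2 (fine_Phi Pz)).
have := prox_forward_le R_proper g_gt0 p_prox Rz.
have := F_quad p z; rewrite ler_norml => /andP[Fz _].
have -> : z - ya = (z - p) - (ya - p) by rewrite opprB addrA subrK.
have -> : p - ya = - (ya - p) by rewrite opprB.
rewrite /forward_backward_subgradient.
set d := z - p in Fz *; set u := ya - p; clearbody d u.
rewrite (enormN u) (enorm_sqrB d u) (dotpBr (G yb) d u) (dotpNr (G yb) u) => prx.
rewrite -(ler_pM2l g_gt0) dotpDl dotpDl dotpNl dotpZl (dotpC u d).
have -> : g * (fine (R p) + F p + (g^-1 * dotp d u - dotp (G yb) d +
   dotp (G p) d) - ((2 * g)^-1 + L / 2) * enorm d ^+ 2) =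
   g * fine (R p) + g * F p + dotp d u - g * dotp (G yb) d +
   g * dotp (G p) d - enorm d ^+ 2 / 2 - g * (L / 2 * enorm d ^+ 2).
  by field; rewrite gt_eqF.
have Fz' : g * - (L / 2 * enorm d ^+ 2) <=
   g * (F z - F p - dotp (G p) d) by rewrite ler_pM2l.
by lra.
Qed.

Lemma enorm_forward_backward_subgradient :
  enorm forward_backward_subgradient <=
  g^-1 * enorm (ya - p) + L * enorm (yb - p).
Proof.
rewrite /forward_backward_subgradient -addrA.
apply: le_trans (enormD _ _) _; rewrite enormZ gtr0_norm ?invr_gt0 // lerD //.
by rewrite addrC [enorm (yb - p)]enormB; exact: F_lip.
Qed.

End ForwardBackwardStep.

Lemma inertial_sub (K : realType) (n s : nat) (c : 'I_s -> nat -> K)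
    (x : nat -> 'rV[K]_n) (k : nat) :
  inertial c x k - x k = \sum_(i < s) c i k *: (x (k - i)%N - x (k - i - 1)%N).
Proof. by rewrite /inertial addrAC subrr add0r. Qed.

Lemma enorm_inertial_sub (K : realType) (n s : nat) (c : 'I_s -> nat -> K)
    (x : nat -> 'rV[K]_n) (k : nat) (C : K) :
  (forall i, `|c i k| <= C) ->
  enorm (inertial c x k - x k) <=
  C * \sum_(i < s) enorm (x (k - i)%N - x (k - i - 1)%N).
Proof.
move=> cC; rewrite inertial_sub mulr_sumr; apply: le_trans (enorm_sum _) _.
by apply: ler_sum => i _; rewrite enormZ ler_wpM2r ?enorm_ge0.
Qed.

Lemma enorm_sqr_inertial_sub (K : realType) (n s : nat) (c : 'I_s -> nat -> K)
    (x : nat -> 'rV[K]_n) (k : nat) :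
  enorm (inertial c x k - x k) ^+ 2 <=
  \sum_(i < s) s%:R * c i k ^+ 2 * enorm (x (k - i)%N - x (k - i - 1)%N) ^+ 2.
Proof.
rewrite inertial_sub.
have h := enorm_sum (fun i : 'I_s => c i k *: (x (k - i)%N - x (k - i - 1)%N)).
have sq := sqr_sum_le (fun i : 'I_s => enorm (c i k *: (x (k - i)%N - x (k - i - 1)%N))).
apply: (le_trans (y := (\sum_(i < s) enorm (c i k *: (x (k - i)%N - x (k - i - 1)%N))) ^+ 2)).
  by rewrite ler_pXn2r ?nnegrE ?enorm_ge0 ?sumr_ge0 // => i _; exact: enorm_ge0.
apply: le_trans sq _; rewrite mulr_sumr; apply: ler_sum => i _.
by rewrite enormZ exprMn real_normK ?num_real // mulrA.
Qed.

Lemma lag_sum_shift (K : realType) (c e : nat -> K) (m k : nat) : c m = 0 ->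
  \sum_(i < m) c i * e (k.+1 - i)%N =
  c 0%N * e k.+1 + \sum_(i < m) c i * e (k - i)%N
  - \sum_(i < m) (c i - c i.+1) * e (k - i)%N.
Proof.
move=> cm; have -> : \sum_(i < m) c i * e (k.+1 - i)%N =
    \sum_(i < m.+1) c i * e (k.+1 - i)%N by rewrite big_ord_recr /= cm mul0r addr0.
rewrite big_ord_recl /= subn0 -addrA; congr (_ + _).
by rewrite -sumrB; apply: eq_bigr => i _; rewrite /bump /= add1n subSS; ring.
Qed.

Lemma sum_sqr_le (K : realType) (m : nat) (e : 'I_m -> K) : (forall i, 0 <= e i) ->
  \sum_(i < m) e i ^+ 2 <= (\sum_(i < m) e i) ^+ 2.
Proof.
move=> e0; rewrite [leRHS]expr2 mulr_suml; apply: ler_sum => i _.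
by rewrite expr2 ler_wpM2l // (bigD1 i) //= lerDl sumr_ge0.
Qed.

Lemma nonincreasing_bounded_inf (K : realType) (u : nat -> K) (N : nat) (m : K) :
  (forall k, (N <= k)%N -> u k.+1 <= u k) -> (forall k, (N <= k)%N -> m <= u k) ->
  exists l, (forall k, (N <= k)%N -> l <= u k) /\
    forall e, 0 < e -> exists M, (N <= M)%N /\ forall k, (M <= k)%N -> u k < l + e.
Proof.
move=> uS um; pose E := [set u k | k in [set k | (N <= k)%N]].
have Einf : has_inf E.
  split; first by exists (u N), N => /=.
  by exists m => _ [k Nk <-]; exact: um.
exists (inf E); split=> [k Nk|e e0].
  by apply: ge_inf; [case: Einf | exists k].
have [_ [M NM <-] Me] := inf_adherent e0 Einf.
exists M; split => // k /subnKC <-; elim: (k - M)%N => [|j IH]; first by rewrite addn0.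
rewrite addnS; apply: le_lt_trans IH; apply: uS.
by rewrite (leq_trans NM) // leq_addr.
Qed.

Lemma bounded_sequence_cluster (K : realType) (n : nat) (x : nat -> 'rV[K]_n) (M : K) :
  (forall k, enorm (x k) <= M) ->
  exists p, forall e N, 0 < e -> exists2 k, (N <= k)%N & enorm (x k - p) < e.
Proof.
move=> xM; pose A := [set y : 'rV[K]_n | `|y| <= M].
have cA : compact A.
  apply: bounded_closed_compact.
    exists M; split; first by rewrite num_real.
    by move=> r /ltW Mr y /= yM; exact: le_trans Mr.
  apply: (@closed_comp _ _ (fun y : 'rV[K]_n => `|y|) [set t | t <= M]).
    by move=> y _; exact: norm_continuous.
  exact: closed_le.
have FA : (x @ \oo) A by exists 0%N => // k _; exact: le_trans (normr_le_enorm _) (xM k).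
have [p [_ clp]] := cA _ _ FA.
exists p => e N e0.
have [] := clp [set x k | k in [set k | (N <= k)%N]] [set y | enorm (y - p) < e].
- by exists N => // k Nk; exists k.
- by apply/nbhs_enormP; exists e.
by move=> _ [[k Nk <-] /= h]; exists k.
Qed.

Lemma finite_length_bounded (K : realType) (n : nat) (x : nat -> 'rV[K]_n)
    (N : nat) (B : K) :
  (forall k, (N <= k)%N -> \sum_(N <= j < k) enorm (x j.+1 - x j) <= B) ->
  finite_length x.
Proof.
move=> hB; pose D k := enorm (x k - x (k - 1)%N).
have D0 k : 0 <= D k by exact: enorm_ge0.
pose C := \sum_(0 <= j < N.+1) D j + B.
apply: (@le_lt_trans _ _ C%:E); last exact: ltry.
apply: lime_le.
  by apply: is_cvg_nneseries => k _ _; rewrite lee_fin enorm_ge0.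
exists N.+1 => // k /= Nk; rewrite sumEFin lee_fin.
rewrite -/(\sum_(0 <= j < k) D j) (big_cat_nat (n := N.+1)) //= lerD //.
case: k Nk => // k Nk; rewrite big_add1 /=; apply: le_trans (hB k Nk).
by apply: ler_sum => j _; rewrite /D subSS subn0.
Qed.

Lemma KL_subgradient (K : realType) (n : nat) (J : 'rV[K]_n -> \bar K)
    (xbar y w : 'rV[K]_n) (eta : \bar K) (phi : K -> K) :
  desingularizing eta phi -> J xbar \is a fin_num -> J y \is a fin_num ->
  0 < fine (J y) - fine (J xbar) -> ((fine (J y) - fine (J xbar))%:E < eta)%E ->
  ((J xbar < J y)%E -> (J y < J xbar + eta)%E ->
    (1 <= (derive1 phi (fine (J y - J xbar)))%:E * edistance 0 (subdiff J y))%E) ->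
  subdiff J y w ->
  1 <= derive1 phi (fine (J y) - fine (J xbar)) * enorm w.
Proof.
move=> dphi Jb Jy h0 heta kl Jw.
have phi' : 0 < derive1 phi (fine (J y) - fine (J xbar)).
  by case: dphi => _ _ _ _ dphi; have [] := dphi _ (conj h0 heta).
rewrite -lee_fin EFinM -(enormN w) -(sub0r w).
apply: le_trans (lee_wpmul2l _ (edistance_le 0 Jw)); last by rewrite lee_fin ltW.
rewrite -fineB //; apply: kl.
  by rewrite -(fineK Jb) -(fineK Jy) lte_fin -subr_gt0.
move: heta; rewrite EFinB !fineK // lteBlDr //; first by rewrite addeC.
Qed.

Lemma trap_entry (K : realType) (eta : \bar K) (phi : K -> K) (C rho : K) :
  desingularizing eta phi -> (0 < eta)%E -> 0 <= C -> 0 < rho ->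
  exists2 d, 0 < d & forall h S r, 0 <= h < d -> S < d -> r < d ->
    (h%:E < eta)%E /\ r + 2 * (C * lyap_desing phi h + S) < rho.
Proof.
move=> dphi eta0 C0 rho0.
have [d1 d10 hd1] : exists2 d1, 0 < d1 & forall h, h < d1 -> (h%:E < eta)%E.
  move: eta0; case: (eta) => [r| |] //; last by exists 1 => // h _; rewrite ltry.
  by rewrite lte_fin => r0; exists r => // h; rewrite lte_fin.
have C10 : 0 < C + 1 by rewrite ltr_wpDl.
have [d2 d20 hd2] := lyap_desing_small dphi eta0
  (divr_gt0 rho0 (mulr_gt0 (ltr0n _ 8) C10)).
exists (Num.min (rho / 8) (Num.min d1 d2)); first by rewrite !lt_min d10 d20 divr_gt0.
move=> h S r /andP[h0]; rewrite !lt_min => /and3P[_ hl1 hl2] /andP[S8 _] /andP[r8 _].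
have heta := hd1 h hl1; split => //.
have := hd2 h _ heta; rewrite h0 hl2 => /(_ isT).
have psi0 := lyap_desing_ge0 dphi h0 heta.
rewrite ltr_pdivlMr ?mulr_gt0 // => psi_lt.
by lra.
Qed.

(** * The sequence of iterates *)

Section MiFBSequence.
Variables (K : realType) (n s : nat) (R : 'rV[K]_n -> \bar K) (F : 'rV[K]_n -> K).
Variables (G : 'rV[K]_n -> 'rV[K]_n) (L mu nu gamma_lo : K).
Variables (gamma : nat -> K) (a b : 'I_s -> nat -> K).
Variables (al : 'I_s -> K) (be : K) (N : nat) (x : nat -> 'rV[K]_n).
Hypothesis R_proper : eproper R.
Hypothesis L_gt0 : 0 < L.
Hypothesis G_lip : elipschitz L G.
Hypothesis F_quad : forall x y,
  `|F y - F x - dotp (G x) (y - x)| <= L / 2 * enorm (y - x) ^+ 2.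
Hypothesis mu_gt0 : 0 < mu.
Hypothesis nu_gt0 : 0 < nu.
Hypothesis gamma_lo_gt0 : 0 < gamma_lo.
Hypothesis gamma_ge : forall k, gamma_lo <= gamma k.
Hypothesis gammaL_le1 : forall k, gamma k * L <= 1.
Hypothesis a_le2 : forall i k, `|a i k| <= 2.
Hypothesis b_le2 : forall i k, `|b i k| <= 2.
Hypothesis al_ge0 : forall i, 0 <= al i.
Hypothesis al_lt_be : \sum_(i < s) al i < be.
Hypothesis be_le : forall k, (N <= k)%N -> be <= MiFB_beta L mu nu gamma k.
Hypothesis al_ge : forall k, (N <= k)%N ->
  forall i, MiFB_alpha L mu nu gamma a b k i <= al i.
Hypothesis x_prox : forall k, prox (gamma k) R
  (inertial a x k - gamma k *: G (inertial b x k)) (x k.+1).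

Let Phi y := (R y + (F y)%:E)%E.
Let D k := enorm (x k - x (k - 1)%N).
Let P k := fine (Phi (x k)).
Let S k := \sum_(i < s.+1) D (k - i)%N.
Let c (j : nat) := \sum_(i < s | (j <= i)%N) al i.
Let W k := \sum_(i < s) c i * D (k - i)%N ^+ 2.
Let del := be - \sum_(i < s) al i.

Let gamma_gt0 k : 0 < gamma k. Proof. exact: lt_le_trans (gamma_ge k). Qed.

Let D_ge0 k : 0 <= D k. Proof. exact: enorm_ge0. Qed.

Let DS k : D k.+1 = enorm (x k.+1 - x k). Proof. by rewrite /D subSS subn0. Qed.

Let del_gt0 : 0 < del. Proof. by rewrite subr_gt0. Qed.

Let S_ge0 k : 0 <= S k. Proof. exact: sumr_ge0. Qed.

Let SE k : S k.+1 = D k.+1 + \sum_(i < s) D (k - i)%N.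
Proof.
by rewrite /S big_ord_recl subn0.
Qed.

Lemma MiFB_fin_num k : (0 < k)%N -> Phi (x k) \is a fin_num.
Proof.
by case: k => // k _; exact: (forward_backward_fin_num F R_proper (gamma_gt0 k) (x_prox k)).
Qed.

Let inertial_le (d : 'I_s -> nat -> K) k : (forall i k, `|d i k| <= 2) ->
  enorm (inertial d x k - x k) + D k.+1 <= 2 * S k.+1.
Proof.
move=> d2; have := enorm_inertial_sub x (fun i => d2 i k).
rewrite -[X in _ <= 2 * X -> _]/(\sum_(i < s) D (k - i)%N) SE => h.
by have := D_ge0 k.+1; lra.
Qed.

Let inertial_next_le (d : 'I_s -> nat -> K) k : (forall i k, `|d i k| <= 2) ->
  enorm (inertial d x k - x k.+1) <= 2 * S k.+1.
Proof.
move=> d2; apply: le_trans (inertial_le k d2).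
apply: le_trans (enorm_sub_trans _ (x k) _) _.
by rewrite DS [enorm (x k.+1 - _)]enormB.
Qed.

Lemma MiFB_step k : (N <= k)%N -> (0 < k)%N ->
  P k.+1 + be * D k.+1 ^+ 2 <= P k + \sum_(i < s) al i * D (k - i)%N ^+ 2.
Proof.
move=> Nk k0.
have h := forward_backward_descent R_proper L_gt0 G_lip F_quad (gamma_gt0 k)
  (x_prox k) mu_gt0 nu_gt0 (MiFB_fin_num k0).
have hb : be * D k.+1 ^+ 2 <= MiFB_beta L mu nu gamma k * D k.+1 ^+ 2.
  by rewrite ler_wpM2r ?sqr_ge0 ?be_le.
have ha : \sum_(i < s) MiFB_alpha L mu nu gamma a b k i * D (k - i)%N ^+ 2 <=
    \sum_(i < s) al i * D (k - i)%N ^+ 2.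
  by apply: ler_sum => i _; rewrite ler_wpM2r ?sqr_ge0 ?al_ge.
suff hs : enorm (inertial a x k - x k) ^+ 2 / (2 * gamma k * mu) +
    L ^+ 2 * enorm (inertial b x k - x k) ^+ 2 / (2 * nu) <=
    \sum_(i < s) MiFB_alpha L mu nu gamma a b k i * D (k - i)%N ^+ 2.
  rewrite -DS in h.
  by move: h hb; rewrite /MiFB_beta -/(P k) -/(P k.+1); lra.
have ea := enorm_sqr_inertial_sub a x k.
have eb := enorm_sqr_inertial_sub b x k.
have ga : 0 <= (2 * gamma k * mu)^-1 by rewrite invr_ge0 ltW // !mulr_gt0.
have gb : 0 <= (2 * nu)^-1 by rewrite invr_ge0 ltW // mulr_gt0.
have {}ea := ler_wpM2r ga ea.
have {}eb := ler_wpM2r gb (ler_wpM2l (sqr_ge0 L) eb).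
apply: le_trans (lerD ea eb) _.
rewrite mulr_sumr !mulr_suml -big_split /= le_eqVlt; apply/orP; left; apply/eqP.
by apply: eq_bigr => i _; rewrite /MiFB_alpha /D; ring.
Qed.

Let v k := forward_backward_subgradient G (gamma k) (inertial a x k)
  (inertial b x k) (x k.+1).

Let sig := 2 * (gamma_lo^-1 + L).

Lemma MiFB_subgradient k : subdiff Phi (x k.+1) (v k).
Proof.
apply: frechet_subdiff_subdiff.
exact: (forward_backward_subgradientP R_proper L_gt0 F_quad (gamma_gt0 k) (x_prox k)).
Qed.

Lemma enorm_MiFB_subgradient k : enorm (v k) <= sig * S k.+1.
Proof.
apply: le_trans (enorm_forward_backward_subgradient _ _ _ G_lip (gamma_gt0 k)) _.
have ha := inertial_next_le k a_le2; have hb := inertial_next_le k b_le2.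
have hg : (gamma k)^-1 <= gamma_lo^-1 by rewrite lef_pV2 ?posrE.
have h1 : (gamma k)^-1 * enorm (inertial a x k - x k.+1) <= gamma_lo^-1 * (2 * S k.+1).
  by rewrite ler_pM ?invr_ge0 ?enorm_ge0 ?(ltW (gamma_gt0 k)).
have h2 : L * enorm (inertial b x k - x k.+1) <= L * (2 * S k.+1).
  by rewrite ler_wpM2l // ltW.
by rewrite /sig; lra.
Qed.

Let c_ge0 j : 0 <= c j. Proof. exact: sumr_ge0. Qed.

Let cs : c s = 0.
Proof. by rewrite /c big_pred0 // => i; rewrite leqNgt ltn_ord. Qed.

Let c0E : c 0%N = \sum_(i < s) al i. Proof. exact: eq_bigl. Qed.

Let c_le j : c j <= c 0%N.
Proof.
rewrite c0E /c [leLHS]big_mkcond; apply: ler_sum => i _ /=.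
by case: ifP => // _.
Qed.

Let c_sub (i : 'I_s) : c i - c i.+1 = al i.
Proof.
rewrite /c (bigD1 i) //= (eq_bigl (fun j : 'I_s => (i < j)%N)) ?addrK // => j.
by rewrite ltn_neqAle andbC -(inj_eq val_inj) eq_sym.
Qed.

Lemma MiFB_lyapunov k : (N <= k)%N -> (0 < k)%N ->
  P k.+1 + W k.+1 + del * D k.+1 ^+ 2 <= P k + W k.
Proof.
move=> Nk k0; have := MiFB_step Nk k0.
rewrite /W (lag_sum_shift (fun j => D j ^+ 2) k cs) c0E.
under [X in _ - X]eq_bigr do rewrite c_sub.
by rewrite /del; lra.
Qed.

Lemma MiFB_lag_energy k : 0 <= W k <= c 0%N * S k ^+ 2.
Proof.
apply/andP; split; first by apply: sumr_ge0 => i _; rewrite mulr_ge0 ?sqr_ge0.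
apply: (@le_trans _ _ (c 0%N * \sum_(i < s) D (k - i)%N ^+ 2)).
  by rewrite mulr_sumr; apply: ler_sum => i _; rewrite ler_wpM2r ?sqr_ge0.
rewrite ler_wpM2l //.
apply: le_trans (sum_sqr_le (fun i => D_ge0 (k - i)%N)) _.
rewrite ler_pXn2r ?nnegrE ?sumr_ge0 // /S big_ord_recr /=.
by rewrite lerDl.
Qed.

Let K0 := maxn N 1.
Let H k := P k + W k.

Let H_noninc k : (K0 <= k)%N -> H k.+1 + del * D k.+1 ^+ 2 <= H k.
Proof. by rewrite geq_max => /andP[Nk k0]; exact: MiFB_lyapunov. Qed.

Let q : K := (2 * s.+1%:R)^-1.
Let C := (sig + 1 + 2 * c 0%N) / (4 * q * del).

(* [T] plays for the step lengths the role that [H] plays for their squares: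
   its lag coefficients turn the bound on [D k.+1] given by [kl_step] into a
   decrease of [T] by [D k.+1 / 2]. *)
Let T phi l k := C * lyap_desing phi (H k - l) +
  \sum_(i < s.+1) (s.+1 - i)%:R * q * D (k - i)%N.

(* [enorm (x k - xbar) + 2 * T k] is nonincreasing while the iterates stay in
   the ball of radius [rho]: started below [rho], they never leave it. *)
Section Trap.
Variables (xbar : 'rV[K]_n) (l rho : K) (eta : \bar K) (phi : K -> K).
Hypothesis dphi : desingularizing eta phi.
Hypothesis l_le : forall k, (K0 <= k)%N -> l <= H k.
Hypothesis KL_iterates : forall k, (0 < k)%N -> enorm (x k - xbar) < rho ->
  0 < P k - l -> ((P k - l)%:E < eta)%E ->
  1 <= derive1 phi (P k - l) * (sig * S k).

Let q_gt0 : 0 < q. Proof. by rewrite invr_gt0 mulr_gt0. Qed.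

Let sig_ge0 : 0 <= sig.
Proof. by rewrite mulr_ge0 // addr_ge0 ?invr_ge0 ?ltW. Qed.

Let C_ge0 : 0 <= C.
Proof.
apply: divr_ge0; first by rewrite addr_ge0 ?mulr_ge0 // addr_ge0.
by rewrite ltW // !mulr_gt0.
Qed.

Let T_ge0 k : (K0 <= k)%N -> ((H k - l)%:E < eta)%E -> 0 <= T phi l k.
Proof.
move=> Kk Heta; apply: addr_ge0.
  rewrite mulr_ge0 //; apply: (lyap_desing_ge0 dphi) => //.
  by rewrite subr_ge0 l_le.
by apply: sumr_ge0 => i _; rewrite !mulr_ge0 ?(ltW q_gt0).
Qed.

Lemma MiFB_trap_step k : (K0 <= k)%N -> enorm (x k - xbar) < rho ->
  ((H k - l)%:E < eta)%E -> T phi l k.+1 + D k.+1 / 2 <= T phi l k.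
Proof.
move=> Kk xk Heta; have [_ k0] : (N <= k)%N /\ (0 < k)%N.
  by move: Kk; rewrite geq_max => /andP[].
have := kl_step (h := P k - l) (W := W k) (H := H k - l) (H' := H k.+1 - l)
  (d := D k.+1) (S := S k) dphi q_gt0 del_gt0 sig_ge0 (c_ge0 0%N).
have HE : H k - l = P k - l + W k by rewrite /H; ring.
have H'0 : 0 <= H k.+1 - l by rewrite subr_ge0 l_le // (leq_trans Kk).
have desc : H k.+1 - l + del * D k.+1 ^+ 2 <= H k - l by have := H_noninc Kk; lra.
move=> /(_ (S_ge0 k) HE (MiFB_lag_energy k) H'0 Heta desc (KL_iterates k0 xk)) dle.
rewrite /T (lag_sum_shift (c := fun i => (s.+1 - i)%:R * q)); last first.
  by rewrite subnn mul0r.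
have -> : \sum_(i < s.+1) ((s.+1 - i)%:R * q - (s.+1 - i.+1)%:R * q) * D (k - i)%N =
    q * S k.
  rewrite mulr_sumr; apply: eq_bigr => i _; congr (_ * _).
  by rewrite subSS subSn -1?ltnS // -natr1; ring.
have -> : (s.+1 - 0)%:R * q = 2^-1.
  by rewrite subn0 /q invfM mulrCA mulfV ?mulr1 ?pnatr_eq0.
by move: dle; rewrite -/C; lra.
Qed.

Lemma MiFB_trap K1 : (K0 <= K1)%N -> ((H K1 - l)%:E < eta)%E ->
  enorm (x K1 - xbar) + 2 * T phi l K1 < rho ->
  forall k, (K1 <= k)%N ->
    [/\ ((H k - l)%:E < eta)%E,
        enorm (x k - xbar) <= enorm (x K1 - xbar) + 2 * T phi l K1,
        H k <= H K1 &
        \sum_(K1 <= j < k) enorm (x j.+1 - x j) <= 2 * T phi l K1].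
Proof.
move=> K01 Heta start k K1k.
suff [h1 h2 h3 h4] : [/\ ((H k - l)%:E < eta)%E,
    enorm (x k - xbar) + 2 * T phi l k <= enorm (x K1 - xbar) + 2 * T phi l K1,
    H k <= H K1 &
    \sum_(K1 <= j < k) enorm (x j.+1 - x j) + 2 * T phi l k <= 2 * T phi l K1].
  have T0 := T_ge0 (leq_trans K01 K1k) h1.
  by split => //; lra.
rewrite -(subnKC K1k); elim: (k - K1)%N => [|j IH].
  by rewrite addn0 big_geq // add0r.
move: IH; set i := (K1 + j)%N => -[h1 h2 h3 h4].
have K0i : (K0 <= i)%N by rewrite (leq_trans K01) // leq_addr.
have T0 := T_ge0 K0i h1.
have xi : enorm (x i - xbar) < rho by lra.
have tr := MiFB_trap_step K0i xi h1.
have Hd : H i.+1 <= H i.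
  have : 0 <= del * D i.+1 ^+ 2 by rewrite mulr_ge0 ?sqr_ge0 // ltW.
  by have := H_noninc K0i; lra.
have di := DS i.
rewrite addnS -/i; split.
- by apply: le_lt_trans h1; rewrite lee_fin; lra.
- by have := enorm_sub_trans (x i.+1) (x i) xbar; lra.
- exact: le_trans h3.
- by rewrite big_nat_recr ?leq_addr //=; lra.
Qed.

End Trap.

Lemma MiFB_T_le phi l k : T phi l k <= C * lyap_desing phi (H k - l) + S k.
Proof.
rewrite lerD2l; apply: ler_sum => i _; rewrite ler_piMl //.
rewrite /q ler_pdivrMr ?mulr_gt0 // mul1r -natrM ler_nat.
by rewrite (leq_trans (leq_subr _ _)) // leq_pmull.
Qed.

Variable m : K.
Hypothesis Phi_ge : forall y, (m%:E <= Phi y)%E.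
Hypothesis Phi_lsc : lower_semicontinuous Phi.

Let P_ge k : (0 < k)%N -> m <= P k.
Proof. by move=> k0; rewrite -lee_fin fineK ?MiFB_fin_num. Qed.

Lemma MiFB_limits : exists l, (forall k, (K0 <= k)%N -> l <= H k) /\
  forall e, 0 < e -> exists2 M, (K0 <= M)%N &
    forall k, (M <= k)%N -> [/\ H k < l + e, S k < e & W k < e].
Proof.
have HS k : (K0 <= k)%N -> H k.+1 <= H k.
  move=> /H_noninc; have : 0 <= del * D k.+1 ^+ 2 by rewrite mulr_ge0 ?sqr_ge0 // ltW.
  by lra.
have Hm k : (K0 <= k)%N -> m <= H k.
  rewrite geq_max => /andP[_ k0]; have /andP[W0 _] := MiFB_lag_energy k.
  by rewrite -[m]addr0 lerD ?P_ge.
have [l [lH Hl]] := nonincreasing_bounded_inf HS Hm.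
exists l; split => //.
have D_small e : 0 < e -> exists M, forall k, (M <= k)%N -> D k < e.
  move=> e0; have [M [K0M hM]] := Hl _ (mulr_gt0 del_gt0 (exprn_gt0 2 e0)).
  exists M.+1 => -[//|k] Mk; rewrite -(ltr_pXn2r (n := 2)) ?nnegrE ?(ltW e0) //.
  rewrite -(ltr_pM2l del_gt0).
  have := H_noninc (leq_trans K0M Mk); have := hM k Mk.
  have := lH k.+1 (leq_trans K0M (leqW Mk)).
  by lra.
have S_small e : 0 < e -> exists M, forall k, (M <= k)%N -> S k < e.
  move=> e0; have e'0 : 0 < e / (2 * s.+1%:R) by rewrite divr_gt0 ?mulr_gt0.
  have [M hM] := D_small _ e'0; exists (M + s)%N => k Mk.
  apply: (@le_lt_trans _ _ (\sum_(i < s.+1) e / (2 * s.+1%:R))).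
    have is_ (i : 'I_s.+1) : (i <= s)%N by rewrite -ltnS.
    apply: ler_sum => i _; apply/ltW/hM.
    have Mik : (M + i <= k)%N by rewrite (leq_trans _ Mk) // leq_add2l.
    by rewrite -(leq_add2r i) subnK // (leq_trans _ Mik) // leq_addl.
  rewrite sumr_const card_ord -[ltLHS]mulr_natl.
  have : (s.+1%:R : K) != 0 by rewrite pnatr_eq0.
  move: (s.+1%:R : K) => t t0.
  have -> : t * (e / (2 * t)) = e / 2 by field.
  by lra.
move=> e e0; have [M1 [K01 h1]] := Hl _ e0; have [M2 h2] := S_small _ e0.
have c1 : 0 < c 0%N + 1 by rewrite ltr_wpDl.
have e10 : 0 < Num.min 1 (e / (c 0%N + 1)) by rewrite lt_min ltr01 divr_gt0.
have [M3 h3] := S_small _ e10.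
exists (maxn M1 (maxn M2 M3)); first by rewrite (leq_trans K01) // leq_maxl.
move=> k; rewrite !geq_max => /and3P[k1 k2 k3]; split; [exact: h1|exact: h2|].
have /andP[_] := MiFB_lag_energy k; have := h3 k k3.
rewrite lt_min => /andP[S1]; rewrite ltr_pdivlMr // => Se Wc.
have Sk := S_ge0 k; have c00 := c_ge0 0%N.
have : c 0%N * S k ^+ 2 <= c 0%N * S k.
  by rewrite ler_wpM2l // expr2 ler_piMr // ltW.
by move: Wc Se Sk; rewrite mulrDr mulr1 [S k * _]mulrC; lra.
Qed.

Section Cluster.
Variables (l : K) (xbar : 'rV[K]_n).
Hypothesis l_le : forall k, (K0 <= k)%N -> l <= H k.
Hypothesis l_lim : forall e, 0 < e -> exists2 M, (K0 <= M)%N &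
    forall k, (M <= k)%N -> [/\ H k < l + e, S k < e & W k < e].
Hypothesis x_cluster : forall e M, 0 < e ->
  exists2 k, (M <= k)%N & enorm (x k - xbar) < e.

Let W_ge0 k : 0 <= W k. Proof. by have /andP[] := MiFB_lag_energy k. Qed.

Let gap_le k e : Phi xbar \is a fin_num -> 0 <= e ->
  enorm (x k.+1 - xbar) <= e -> S k.+1 <= e ->
  P k.+1 <= fine (Phi xbar) + 11 * e ^+ 2 / gamma_lo.
Proof.
move=> Pb e0 xe Se.
have := forward_backward_competitor R_proper F_quad (gamma_gt0 k) (x_prox k) Pb.
rewrite -/(P k.+1).
have ha := inertial_next_le k a_le2; have hb := inertial_next_le k b_le2.
set da := enorm (x k.+1 - inertial a x k); set db := enorm (x k.+1 - inertial b x k).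
set ea := enorm (xbar - _); set eb := enorm (xbar - _).
have tri w : enorm (xbar - w) <= enorm (x k.+1 - xbar) + enorm (w - x k.+1).
  by rewrite enormB [leRHS]addrC; exact: enorm_sub_trans.
have ea3 : ea <= 3 * e by have := tri (inertial a x k); rewrite -/ea; lra.
have eb3 : eb <= 3 * e by have := tri (inertial b x k); rewrite -/eb; lra.
have db2 : db <= 2 * e by rewrite /db enormB; lra.
have sq r t : 0 <= r -> 0 <= t -> r <= t -> r ^+ 2 <= t ^+ 2.
  by move=> r0 t0; rewrite ler_pXn2r ?nnegrE.
have ea9 : ea ^+ 2 <= (3 * e) ^+ 2 by rewrite sq ?enorm_ge0 ?mulr_ge0.
have eb9 : eb ^+ 2 <= (3 * e) ^+ 2 by rewrite sq ?enorm_ge0 ?mulr_ge0.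
have db4 : db ^+ 2 <= (2 * e) ^+ 2 by rewrite sq ?enorm_ge0 ?mulr_ge0.
have gl : 0 <= gamma k * L <= 1 by rewrite gammaL_le1 mulr_ge0 // ltW.
have gdb : gamma k * L / 2 * db ^+ 2 <= 2^-1 * db ^+ 2.
  by rewrite ler_wpM2r ?sqr_ge0 //; lra.
have geb : gamma k * L / 2 * eb ^+ 2 <= 2^-1 * eb ^+ 2.
  by rewrite ler_wpM2r ?sqr_ge0 //; lra.
have da0 := sqr_ge0 da.
move=> comp; have {comp} : gamma k * (P k.+1 - fine (Phi xbar)) <= 11 * e ^+ 2.
  by move: comp ea9 eb9 db4; rewrite !exprMn; lra.
rewrite -ler_pdivlMl // mulrC => h.
have : 11 * e ^+ 2 / gamma k <= 11 * e ^+ 2 / gamma_lo.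
  by rewrite ler_wpM2l ?mulr_ge0 ?sqr_ge0 // lef_pV2 ?posrE.
by lra.
Qed.

Lemma MiFB_cluster_value : Phi xbar = l%:E.
Proof.
have Pl : (Phi xbar <= l%:E)%E.
  rewrite leNgt; apply/negP => lP.
  have [r lr rP] : exists2 r, l < r & (r%:E < Phi xbar)%E.
    move: lP; case: (Phi xbar) => [r| |] //=.
      by rewrite lte_fin => lr; exists ((l + r) / 2); rewrite ?lte_fin; lra.
    by move=> _; exists (l + 1); rewrite ?ltry //; lra.
  have [V /nbhs_enormP[d d0 dV] hV] := Phi_lsc rP.
  have rl0 : 0 < r - l by rewrite subr_gt0.
  have [M K0M hM] := l_lim rl0.
  have [k Mk /dV /hV] := x_cluster M d0.
  have k0 : (0 < k)%N by apply: leq_trans Mk; apply: leq_trans K0M; exact: leq_maxr.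
  rewrite -(fineK (MiFB_fin_num k0)) lte_fin -/(P k) => rPk.
  have [Hk _ _] := hM k Mk; have := W_ge0 k.
  by move: Hk; rewrite /H; lra.
have Pfin : Phi xbar \is a fin_num.
  rewrite fin_numE; apply/andP; split.
    by rewrite gt_eqF // (lt_le_trans (ltNyr m)).
  by rewrite lt_eqF // (le_lt_trans Pl) // ltry.
apply/eqP; rewrite eq_le Pl /= -(fineK Pfin) lee_fin.
apply/ler_addgt0Pr => e0 e0_gt0.
pose A := 11 / gamma_lo + 1.
have A0 : 0 < A by rewrite ltr_wpDl ?divr_ge0 // ltW.
pose e := Num.min 1 (e0 / A).
have e_gt0 : 0 < e by rewrite lt_min ltr01 divr_gt0.
have e1 : e <= 1 by rewrite ge_min lexx.
have eA : A * e <= e0.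
  by rewrite mulrC -ler_pdivlMr // ge_min lexx orbT.
have [M K0M hM] := l_lim e_gt0.
have [[|k] Mk xk] := x_cluster M.+1 e_gt0 => //.
have [_ /ltW Sk /ltW Wk] := hM k.+1 (ltnW Mk).
have := gap_le Pfin (ltW e_gt0) (ltW xk) Sk.
have := l_le (leq_trans K0M (ltnW Mk)).
have ee : e ^+ 2 <= e by rewrite expr2 ler_piMr // ltW.
have : 11 * e ^+ 2 / gamma_lo <= 11 / gamma_lo * e.
  by rewrite mulrAC ler_wpM2l // divr_ge0 // ltW.
by move: eA; rewrite /A /H; lra.
Qed.

Lemma MiFB_cluster_crit : crit Phi xbar.
Proof.
have Pb := MiFB_cluster_value.
rewrite /crit /= /subdiff /=; split; first by rewrite /edom /= Pb ltry.
have inv0 (j : nat) : 0 < (j.+1%:R : K)^-1 by rewrite invr_gt0.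
have ex (j : nat) : exists k, (j.+1 <= k)%N && (enorm (x k - xbar) < (j.+1%:R)^-1).
  have [k jk xk] := x_cluster j.+1 (inv0 j).
  by exists k; rewrite jk.
pose f j := xchoose (ex j).
have f_ge j : (j < f j)%N by have /andP[] := xchooseP (ex j).
have f_near j : enorm (x (f j) - xbar) < (j.+1%:R)^-1.
  by have /andP[] := xchooseP (ex j).
have f0 j : (0 < f j)%N by exact: leq_trans (f_ge j).
have fS j : (f j).-1.+1 = f j by rewrite prednK.
exists (fun j => x (f j)), (fun j => v (f j).-1); split.
- apply/cvg_enormP => e e0.
  have [M hM] : exists M : nat, e^-1 < M%:R.
    by exists (Num.truncn e^-1).+1; exact: truncnS_gt.
  exists M => k Mk; apply: lt_le_trans (f_near k) _.
  rewrite -[e]invrK lef_pV2 ?posrE ?invr_gt0 //.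
  by rewrite (le_trans (ltW hM)) // ler_nat leqW.
- rewrite Pb (_ : (fun j => _) = (fun j => (P (f j))%:E)); last first.
    by apply/funext => j; rewrite fineK // MiFB_fin_num.
  apply: cvg_EFin; first by apply: nearW.
  apply/cvgrPdist_lt => e e0; have [M K0M hM] := l_lim e0.
  exists M => // k /= Mk.
  have Mf : (M <= f k)%N by rewrite (leq_trans Mk) // ltnW.
  have [h1 _ h3] := hM _ Mf; have h4 := l_le (leq_trans K0M Mf).
  have h5 := W_ge0 (f k).
  by rewrite ltr_norml; move: h1 h4; rewrite /H => h1 h4; apply/andP; split; lra.
- move=> j; rewrite -{1}fS.
  exact: (forward_backward_subgradientP R_proper L_gt0 F_quad (gamma_gt0 _) (x_prox _)).
- apply/cvg_enormP => e e0.
  have s0 : 0 < sig by rewrite mulr_gt0 // addr_gt0 ?invr_gt0.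
  have [M K0M hM] := l_lim (divr_gt0 e0 s0).
  exists M => k Mk; rewrite subr0.
  apply: le_lt_trans (enorm_MiFB_subgradient _) _; rewrite fS.
  have [_ h _] := hM (f k) (leq_trans Mk (ltnW (f_ge k))).
  by move: h; rewrite ltr_pdivlMr // mulrC.
Qed.

End Cluster.

Let iterates_KL (xbar : 'rV[K]_n) (eta : \bar K) (phi : K -> K) (rho : K) :
  desingularizing eta phi -> Phi xbar \is a fin_num ->
  (forall y, enorm (y - xbar) < rho -> (Phi xbar < Phi y)%E ->
    (Phi y < Phi xbar + eta)%E ->
    (1 <= (derive1 phi (fine (Phi y - Phi xbar)))%:E * edistance 0 (subdiff Phi y))%E) ->
  forall k, (0 < k)%N -> enorm (x k - xbar) < rho ->
    0 < P k - fine (Phi xbar) -> ((P k - fine (Phi xbar))%:E < eta)%E ->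
    1 <= derive1 phi (P k - fine (Phi xbar)) * (sig * S k).
Proof.
move=> dphi Pb kl [//|k] _ xk h0 heta.
have Pk := MiFB_fin_num (ltn0Sn k).
apply: le_trans (KL_subgradient dphi Pb Pk h0 heta (kl _ xk) (MiFB_subgradient k)) _.
rewrite ler_wpM2l ?enorm_MiFB_subgradient // ltW //.
by case: dphi => _ _ _ _ dphi; have [] := dphi _ (conj h0 heta).
Qed.

Lemma MiFB_bounded : KL_function Phi -> (exists B, forall k, enorm (x k) <= B) ->
  finite_length x /\ exists2 xstar, crit Phi xstar & x @ \oo --> xstar.
Proof.
move=> KLf [B xB].
have [l [l_le l_lim]] := MiFB_limits.
have [p x_cluster] := bounded_sequence_cluster xB.
have x_cluster' e M : 0 < e -> exists2 k, (M <= k)%N & enorm (x k - p) < e.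
  exact: x_cluster.
have Pp := MiFB_cluster_value l_le l_lim x_cluster'.
have critp := MiFB_cluster_crit l_le l_lim x_cluster'.
have [_ [eta [U [phi [eta0 /nbhs_enormP[rho rho0 rhoU] dphi kl]]]]] :=
  KLf p (ex_intro _ 0 critp).
have Pfin : Phi p \is a fin_num by rewrite Pp.
have := iterates_KL dphi Pfin (fun y yr => kl y (rhoU y yr)).
rewrite Pp /= => klx.
have C_ge0 : 0 <= C.
  apply: divr_ge0; first by rewrite addr_ge0 ?mulr_ge0 // addr_ge0 // mulr_ge0 //
    addr_ge0 ?invr_ge0 // ltW.
  by rewrite ltW // !mulr_gt0 // invr_gt0 mulr_gt0.
have enter e : 0 < e -> exists K1, [/\ (K0 <= K1)%N, ((H K1 - l)%:E < eta)%E &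
    enorm (x K1 - p) + 2 * T phi l K1 < e].
  move=> e0; have [d d0 hd] := trap_entry dphi eta0 C_ge0 e0.
  have [M K0M hM] := l_lim d d0; have [k Mk xk] := x_cluster' d M d0.
  have [Hk Sk _] := hM k Mk; have K0k := leq_trans K0M Mk.
  have h0 : 0 <= H k - l < d by have := l_le k K0k; move: Hk => *; apply/andP; split; lra.
  have [h1 h2] := hd _ _ _ h0 Sk xk; exists k; split => //.
  by apply: le_lt_trans h2; rewrite lerD2l ler_wpM2l ?MiFB_T_le.
split.
  have [K1 [K01 h1 h2]] := enter rho rho0.
  apply: (@finite_length_bounded _ _ _ K1 (2 * T phi l K1)) => k K1k.
  by have [_ _ _] := MiFB_trap dphi l_le klx K01 h1 h2 K1k.
exists p => //; apply/cvg_enormP => e e0.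
have e'0 : 0 < Num.min rho e by rewrite lt_min rho0.
have [K1 [K01 h1]] := enter _ e'0; rewrite lt_min => /andP[h2 h3].
exists K1 => k K1k; have [_ h4 _ _] := MiFB_trap dphi l_le klx K01 h1 h2 K1k.
exact: le_lt_trans h4 h3.
Qed.

Lemma MiFB_local (xbar : 'rV[K]_n) (eta : \bar K) (phi : K -> K) (rho d d1 : K) :
  KL_function Phi -> argmin Phi xbar -> Phi xbar \is a fin_num ->
  desingularizing eta phi ->
  (forall y, enorm (y - xbar) < rho -> (Phi xbar < Phi y)%E ->
    (Phi y < Phi xbar + eta)%E ->
    (1 <= (derive1 phi (fine (Phi y - Phi xbar)))%:E * edistance 0 (subdiff Phi y))%E) ->
  (forall h S r, 0 <= h < d -> S < d -> r < d ->
    (h%:E < eta)%E /\ r + 2 * (C * lyap_desing phi h + S) < rho) ->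
  d1 + c 0%N * (s.+1%:R * (2 * d1)) ^+ 2 < d -> s.+1%:R * (2 * d1) < d -> d1 < d ->
  (forall j, (j <= K0)%N -> enorm (x j - xbar) <= d1) ->
  P K0 - fine (Phi xbar) <= d1 ->
  (exists2 xlim, argmin Phi xlim & x @ \oo --> xlim) /\ finite_length x.
Proof.
move=> KLf xmin Pb dphi kl entry d1W d1S d1d xd Pd.
set l := fine (Phi xbar) in Pd.
have klx := iterates_KL dphi Pb kl.
have K0_gt0 : (0 < K0)%N by exact: leq_maxr.
have l_leP k : (K0 <= k)%N -> l <= P k.
  move=> K0k; have k0 := leq_trans K0_gt0 K0k.
  by rewrite -lee_fin !fineK ?MiFB_fin_num //; exact: xmin.
have l_le k : (K0 <= k)%N -> l <= H k.
  move=> /l_leP; have /andP[+ _] := MiFB_lag_energy k.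
  by rewrite /H => h1 h2; rewrite -[l]addr0 lerD.
have SK0 : S K0 <= s.+1%:R * (2 * d1).
  apply: (@le_trans _ _ (\sum_(i < s.+1) 2 * d1)).
    apply: ler_sum => i _; apply: le_trans (enorm_sub_trans _ xbar _) _.
    rewrite [enorm (xbar - _)]enormB.
    have j0 : (K0 - i <= K0)%N by exact: leq_subr.
    have j1 : (K0 - i - 1 <= K0)%N by rewrite (leq_trans (leq_subr _ _)).
    by have := xd _ j0; have := xd _ j1; lra.
  by rewrite sumr_const card_ord -[leLHS]mulr_natl.
have HK0 : 0 <= H K0 - l < d.
  rewrite subr_ge0 l_le //=; have /andP[_ WS] := MiFB_lag_energy K0.
  have : c 0%N * S K0 ^+ 2 <= c 0%N * (s.+1%:R * (2 * d1)) ^+ 2.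
    by rewrite ler_wpM2l // ler_pXn2r ?nnegrE // (le_trans (S_ge0 K0)).
  by rewrite /H; move: WS Pd d1W => *; lra.
have [h1 h2] := entry _ _ _ HK0 (le_lt_trans SK0 d1S) (le_lt_trans (xd K0 (leqnn _)) d1d).
have h3 : enorm (x K0 - xbar) + 2 * T phi l K0 < rho.
  by apply: le_lt_trans h2; rewrite lerD2l ler_wpM2l ?MiFB_T_le.
have trap := MiFB_trap dphi l_le klx (leqnn K0) h1 h3.
set r0 := enorm (x K0 - xbar) + 2 * T phi l K0 in h3 trap.
have xbd : exists B, forall k, enorm (x k) <= B.
  exists (d1 + r0 + enorm xbar) => k.
  have xk : enorm (x k - xbar) <= d1 + r0.
    have d10 : 0 <= d1 by apply: le_trans (xd 0%N _) => //; exact: enorm_ge0.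
    have [kK|/ltnW Kk] := leqP k K0.
      have r00 : 0 <= r0 by have [_ + _ _] := trap _ (leqnn K0); apply: le_trans; exact: enorm_ge0.
      by have := xd k kK; lra.
    by have [_ + _ _] := trap _ Kk; lra.
  by have := enormD (x k - xbar) xbar; rewrite subrK; lra.
have [flx [xlim clim xl]] := MiFB_bounded KLf xbd.
split => //; exists xlim => //.
have /cvg_enormP xle := xl.
have [l' [l'_le l'_lim]] := MiFB_limits.
have Plim : Phi xlim = l'%:E.
  apply: (MiFB_cluster_value l'_le l'_lim) => e M e0.
  have [M' hM'] := xle e e0; exists (maxn M M'); first exact: leq_maxl.
  by apply: hM'; exact: leq_maxr.
have xlim_rho : enorm (xlim - xbar) < rho.
  have rr0 : 0 < rho - r0 by rewrite subr_gt0.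
  have [M hM] := xle _ rr0.
  have := hM (maxn M K0) (leq_maxl _ _).
  have [_ + _ _] := trap (maxn M K0) (leq_maxr _ _).
  have := enorm_sub_trans xlim (x (maxn M K0)) xbar.
  by rewrite [enorm (xlim - x _)]enormB => *; lra.
have l'H : l' - l <= H K0 - l by rewrite lerB // l'_le.
have ll' : l <= l' by rewrite -lee_fin -Plim fineK //; exact: xmin.
have l'E : l' = l.
  apply/eqP; rewrite eq_le ll' andbT leNgt; apply/negP => lt.
  have Pfin : Phi xlim \is a fin_num by rewrite Plim.
  have gap0 : 0 < fine (Phi xlim) - fine (Phi xbar) by rewrite Plim subr_gt0.
  have gap_eta : ((fine (Phi xlim) - fine (Phi xbar))%:E < eta)%E.
    by rewrite Plim /=; apply: le_lt_trans h1; rewrite lee_fin.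
  have := KL_subgradient dphi Pb Pfin gap0 gap_eta (kl _ xlim_rho) clim.
  by rewrite enorm0 mulr0 ler10.
by move=> y; rewrite Plim l'E fineK //; exact: xmin.
Qed.

End MiFBSequence.

Section MiFBStart.
Variables (K : realType) (n s : nat) (R : 'rV[K]_n -> \bar K) (F : 'rV[K]_n -> K).
Variables (G : 'rV[K]_n -> 'rV[K]_n) (L gamma_lo th : K).
Variables (gamma : nat -> K) (a b : 'I_s -> nat -> K) (xbar : 'rV[K]_n).
Hypothesis R_proper : eproper R.
Hypothesis F_quad : forall x y,
  `|F y - F x - dotp (G x) (y - x)| <= L / 2 * enorm (y - x) ^+ 2.
Hypothesis L_gt0 : 0 < L.
Hypothesis gamma_lo_gt0 : 0 < gamma_lo.
Hypothesis gamma_ge : forall k, gamma_lo <= gamma k.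
Hypothesis gammaL_le : forall k, gamma k * L <= th.
Hypothesis th_lt1 : th < 1.
Hypothesis a_le2 : forall i k, `|a i k| <= 2.
Hypothesis b_le2 : forall i k, `|b i k| <= 2.

Let Phi y := (R y + (F y)%:E)%E.
Hypothesis xbar_min : argmin Phi xbar.
Hypothesis Phi_xbar : Phi xbar \is a fin_num.

Let gamma_gt0 k : 0 < gamma k. Proof. exact: lt_le_trans (gamma_ge k). Qed.

Let A : K := 1 + 4 * s%:R.
Let B : K := 6 / (1 - th).

(* Comparing with [xbar] in the proximal subproblem works for every step size
   allowed, before the descent inequality holds and even if [Phi (x 0)] is
   infinite; minimality of [xbar] makes the quadratic terms control [x k.+1]. *)
Lemma MiFB_near_minimizer_step (x : nat -> 'rV[K]_n) (k : nat) (e : K) :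
  prox (gamma k) R (inertial a x k - gamma k *: G (inertial b x k)) (x k.+1) ->
  0 <= e -> (forall j, (j <= k)%N -> enorm (x j - xbar) <= e) ->
  enorm (x k.+1 - xbar) <= B * (A * e) /\
  gamma_lo * (fine (Phi (x k.+1)) - fine (Phi xbar)) <= (1 + (B + 1) ^+ 2) * (A * e) ^+ 2.
Proof.
move=> xk1 e0 xe.
have near (d : 'I_s -> nat -> K) : (forall i k, `|d i k| <= 2) ->
    enorm (inertial d x k - xbar) <= A * e.
  move=> d2; apply: le_trans (enorm_sub_trans _ (x k) _) _.
  have := enorm_inertial_sub x (fun i => d2 i k).
  have : \sum_(i < s) enorm (x (k - i)%N - x (k - i - 1)%N) <= s%:R * (2 * e).
    apply: (@le_trans _ _ (\sum_(i < s) 2 * e)).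
      apply: ler_sum => i _; apply: le_trans (enorm_sub_trans _ xbar _) _.
      rewrite [enorm (xbar - _)]enormB.
      have j0 : (k - i <= k)%N by exact: leq_subr.
      have j1 : (k - i - 1 <= k)%N by rewrite (leq_trans (leq_subr _ _)).
      by have := xe _ j0; have := xe _ j1; lra.
    by rewrite sumr_const card_ord -[leLHS]mulr_natl.
  by have := xe k (leqnn k); rewrite /A; lra.
have Pfin : Phi (x k.+1) \is a fin_num.
  exact: (forward_backward_fin_num F R_proper (gamma_gt0 k) xk1).
have gap0 : 0 <= fine (Phi (x k.+1)) - fine (Phi xbar).
  by rewrite subr_ge0 -lee_fin !fineK //; exact: xbar_min.
have := forward_backward_competitor R_proper F_quad (gamma_gt0 k) xk1 Phi_xbar.
have na := near a a_le2; have nb := near b b_le2;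
set r := enorm (x k.+1 - xbar).
have hya : r <= enorm (x k.+1 - inertial a x k) + A * e.
  by apply: le_trans (enorm_sub_trans _ (inertial a x k) _) _; rewrite lerD2l.
have hyb : enorm (x k.+1 - inertial b x k) <= r + A * e.
  apply: le_trans (enorm_sub_trans _ xbar _) _.
  by rewrite lerD2l enormB.
rewrite -[enorm (inertial a x k - xbar)]enormB in na.
rewrite -[enorm (inertial b x k - xbar)]enormB in nb.
move: gap0 na nb hya hyb (enorm_ge0 (xbar - inertial a x k))
  (enorm_ge0 (xbar - inertial b x k)) (enorm_ge0 (x k.+1 - inertial a x k))
  (enorm_ge0 (x k.+1 - inertial b x k)) (enorm_ge0 (x k.+1 - xbar)).
rewrite -/r.
move: (enorm (xbar - inertial a x k)) (enorm (xbar - inertial b x k))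
  (enorm (x k.+1 - inertial a x k)) (enorm (x k.+1 - inertial b x k)) => ea eb da db.
set gap := _ - _ => gap0 na nb hya hyb ea0 eb0 da0 db0 r0 comp.
have A0 : 0 <= A * e by rewrite mulr_ge0 // addr_ge0 ?mulr_ge0.
have th0 : 0 < th by apply: lt_le_trans (gammaL_le k); rewrite mulr_gt0.
have B0 : 6 <= B.
  by rewrite /B ler_pdivlMr ?subr_gt0 //; lra.
have sq (u t : K) : 0 <= u -> u <= t -> u ^+ 2 <= t ^+ 2.
  by move=> u0 ut; rewrite ler_pXn2r ?nnegrE // (le_trans u0).
move: (A * e) A0 na nb hya hyb => A' A'0 na nb hya hyb.
have ea2 := sq _ _ ea0 na; have eb2 := sq _ _ eb0 nb; have db2 := sq _ _ db0 hyb.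
have gL0 : 0 <= gamma k * L by rewrite mulr_ge0 // ltW.
have g1 : gamma k * L / 2 * eb ^+ 2 <= 2^-1 * A' ^+ 2.
  apply: ler_pM; rewrite ?sqr_ge0 ?divr_ge0 //.
  by have := gammaL_le k; have := th_lt1; lra.
have g2 : gamma k * L / 2 * db ^+ 2 <= th / 2 * (r + A') ^+ 2.
  apply: ler_pM; rewrite ?sqr_ge0 ?divr_ge0 //.
  by have := gammaL_le k; have := th_lt1; lra.
have g3 : 0 <= gamma k * gap by rewrite mulr_ge0 // ltW.
have comp' : gamma k * gap + 2^-1 * da ^+ 2 <= A' ^+ 2 + th / 2 * (r + A') ^+ 2.
  by move: comp g1 g2 ea2; rewrite /gap; lra.
have rB : r <= B * A'.
  have [rA|Ar] := leP r A'; first by apply: le_trans rA _; rewrite ler_peMl //; lra.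
  have da2 : (r - A') ^+ 2 <= da ^+ 2 by apply: sq; lra.
  rewrite /B mulrAC ler_pdivlMr ?subr_gt0 //.
  have : r * (r * (1 - th)) <= r * (6 * A').
    have t1 : th * (2 * (r * A') + A' ^+ 2) <= 1 * (2 * (r * A') + A' ^+ 2).
      have u0 : 0 <= 2 * (r * A') + A' ^+ 2 by rewrite addr_ge0 ?sqr_ge0 ?mulr_ge0.
      by rewrite ler_wpM2r // ltW.
    have t2 : A' * A' <= r * A' by rewrite ler_wpM2r // ltW.
    by move: t1; lra.
  by rewrite ler_pM2l // (le_lt_trans A'0).
split=> //.
have rA2 : (r + A') ^+ 2 <= ((B + 1) * A') ^+ 2 by apply: sq; lra.
have gg : gamma_lo * gap <= gamma k * gap by rewrite ler_wpM2r.
have tt : th / 2 * (r + A') ^+ 2 <= 1 * ((B + 1) * A') ^+ 2.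
  by apply: ler_pM; rewrite ?sqr_ge0 //; have := th_lt1; lra.
have := sqr_ge0 da.
by move: tt; rewrite exprMn mul1r; lra.
Qed.

Lemma MiFB_start (k : nat) (e : K) : 0 < e ->
  exists2 d, 0 < d & forall x : nat -> 'rV[K]_n,
    (forall k, prox (gamma k) R
       (inertial a x k - gamma k *: G (inertial b x k)) (x k.+1)) ->
    enorm (x 0%N - xbar) < d ->
    forall j, (j <= k)%N -> enorm (x j - xbar) <= e /\
      ((0 < j)%N -> fine (Phi (x j)) - fine (Phi xbar) <= e).
Proof.
have A1 : 1 <= A by rewrite lerDl mulr_ge0.
have B0 : 0 < B by rewrite divr_gt0 // subr_gt0.
pose C := (1 + (B + 1) ^+ 2) / gamma_lo.
have C0 : 0 < C by rewrite divr_gt0 // ltr_pwDl // sqr_ge0.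
elim: k e => [|k IH] e e0.
  exists e => // x _ x0 j; rewrite leqn0 => /eqP ->; split => //; exact: ltW.
pose M := A * (B + C + 1).
have A0 : 0 < A by apply: lt_le_trans A1.
have M0 : 0 < M by apply: mulr_gt0 => //; rewrite !addr_gt0.
pose e1 := Num.min 1 e / M.
have e10 : 0 < e1 by rewrite divr_gt0 // lt_min ltr01.
have e1M : M * e1 = Num.min 1 e by rewrite mulrC divfK // gt_eqF.
have [d d0 hd] := IH _ e10; exists d => // x xprox x0 j.
have step := hd x xprox x0.
have BCA : A * e1 * (B + C + 1) <= Num.min 1 e by rewrite -e1M /M; lra.
have Ae0 : 0 < A * e1 by rewrite mulr_gt0.
have Bc : 0 < (A * e1) * B by rewrite mulr_gt0.
have Cc : 0 < (A * e1) * C by rewrite mulr_gt0.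
have min1 : Num.min 1 e <= 1 by rewrite ge_min lexx.
have mine : Num.min 1 e <= e by rewrite ge_min lexx orbT.
have e1e : e1 <= e.
  have : e1 <= A * e1 by rewrite ler_peMl // ltW.
  by move: BCA; rewrite !mulrDr mulr1; lra.
rewrite leq_eqVlt => /predU1P[->|]; last first.
  rewrite ltnS => /step[h1 h2]; split=> [|/h2 h]; exact: le_trans e1e.
have [h1 h2] := MiFB_near_minimizer_step (xprox k) (ltW e10)
  (fun j jk => proj1 (step j jk)).
split; first by move: BCA; rewrite !mulrDr mulr1; lra.
move=> _; move: h2; rewrite mulrC -ler_pdivlMr // => h2; apply: le_trans h2 _.
rewrite mulrAC -/C.
have : C * (A * e1) ^+ 2 <= C * (A * e1).
  rewrite ler_wpM2l ?(ltW C0) // expr2 ler_piMr ?(ltW Ae0) //.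
  by move: BCA; rewrite !mulrDr mulr1; lra.
by move: BCA; rewrite !mulrDr mulr1; lra.
Qed.

End MiFBStart.

Theorem theorem2p2 (K : realType) (n : nat)
    (R : 'rV[K]_n -> \bar K) (F : 'rV[K]_n -> K) (L : K)
    (R_proper : eproper R)
    (R_lsc : lower_semicontinuous R)
    (R_bounded_below : bounded_below R)
    (F_diff : forall x, differentiable F x)
    (L_gt0 : 0 < L)
    (F_grad_lip : elipschitz L (grad F))
    (Phi : 'rV[K]_n -> \bar K)
    (Phi_def : Phi = (fun x => (R x + (F x)%:E)%E))
    (Phi_proper : eproper Phi)
    (Phi_lsc : lower_semicontinuous Phi)
    (Phi_KL : KL_function Phi)
    (Phi_bounded_below : bounded_below Phi)
    (s : nat) (s_ge1 : (1 <= s)%N)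
    (gamma : nat -> K) (a b : 'I_s -> nat -> K) (gamma_lo gamma_hi : K)
    (gamma_lo_gt0 : 0 < gamma_lo)
    (gamma_bounds : forall k, gamma_lo <= gamma k <= gamma_hi)
    (gamma_hi_lt : gamma_hi < 1 / L)
    (a_bounds : forall i k, -1 < a i k <= 2)
    (b_bounds : forall i k, -1 < b i k <= 2)
    (mu nu : K) (mu_gt0 : 0 < mu) (nu_gt0 : 0 < nu)
    (delta_gt0 : (0 < MiFB_delta L mu nu gamma a b)%E) :
  (forall x : nat -> 'rV[K]_n,
     MiFB R F gamma a b x ->
     (exists M : K, forall k, enorm (x k) <= M) ->
     finite_length x /\
     exists2 xstar, crit Phi xstar & x @ \oo --> xstar) /\
  (forall xstar : 'rV[K]_n,
     argmin Phi xstar -> KL_at Phi xstar ->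
     \forall x0 \near xstar, forall x : nat -> 'rV[K]_n,
       MiFB R F gamma a b x -> x 0%N = x0 ->
       (exists2 xlim, argmin Phi xlim & x @ \oo --> xlim) /\
       finite_length x).
Proof.
subst Phi; set Phi := (fun x => (R x + (F x)%:E)%E) in Phi_proper Phi_lsc Phi_KL
  Phi_bounded_below *.
have gamma_ge k : gamma_lo <= gamma k by have /andP[] := gamma_bounds k.
have th_lt1 : gamma_hi * L < 1 by rewrite -ltr_pdivlMr.
have gammaL_le k : gamma k * L <= gamma_hi * L.
  by rewrite ler_wpM2r ?(ltW L_gt0) //; have /andP[] := gamma_bounds k.
have gammaL_le1 k : gamma k * L <= 1 by exact: le_trans (gammaL_le k) (ltW th_lt1).
have le2 (d : 'I_s -> nat -> K) : (forall i k, -1 < d i k <= 2) ->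
    forall i k, `|d i k| <= 2.
  by move=> h i k; rewrite ler_norml; have := h i k => /andP[h1 h2]; apply/andP; split; lra.
have a_le2 := le2 _ a_bounds; have b_le2 := le2 _ b_bounds.
have [al [be [N [al_ge0 al_lt_be be_le al_ge]]]] := MiFB_delta_eventually s_ge1
  gamma_lo_gt0 mu_gt0 nu_gt0 gamma_ge a_le2 b_le2 delta_gt0.
have F_quad x y := descent_lemma x y F_diff F_grad_lip.
have [m Phi_ge] := Phi_bounded_below.
have bounded x (xP : MiFB R F gamma a b x) := MiFB_bounded R_proper L_gt0 F_grad_lip
  F_quad mu_gt0 nu_gt0 gamma_lo_gt0 gamma_ge gammaL_le1 a_le2 b_le2 al_ge0 al_lt_be
  be_le al_ge xP Phi_ge Phi_lsc Phi_KL.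
split=> [x xP|xstar xmin [xdom [eta [U [phi [eta0 /nbhs_enormP[rho rho0 rhoU] dphi kl]]]]]].
  exact: bounded.
have Pfin : Phi xstar \is a fin_num.
  by rewrite fin_numE gt_eqF ?(proj1 Phi_proper) //= lt_eqF.
pose c := \sum_(i < s | (0 <= i)%N) al i.
have c0 : 0 <= c by apply: sumr_ge0.
pose C := (2 * (gamma_lo^-1 + L) + 1 + 2 * c) /
  (4 * (2 * s.+1%:R)^-1 * (be - \sum_(i < s) al i)).
have C0 : 0 <= C.
  apply: divr_ge0.
    by rewrite !addr_ge0 ?mulr_ge0 ?addr_ge0 ?invr_ge0 // ltW.
  by rewrite ltW // mulr_gt0 ?subr_gt0 // mulr_gt0 // invr_gt0 mulr_gt0.
have [d d0 entry] := trap_entry dphi eta0 C0 rho0.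
pose t : K := s.+1%:R; have t0 : 0 < t by rewrite ltr0n.
pose M := 1 + 2 * t + 4 * c * t ^+ 2.
have ct0 : 0 <= 4 * c * t ^+ 2 by rewrite !mulr_ge0 ?sqr_ge0.
have M0 : 0 < M by rewrite /M; lra.
pose d1 := Num.min 1 d / (2 * M).
have min0 : 0 < Num.min 1 d by rewrite lt_min ltr01.
have d10 : 0 < d1 by rewrite divr_gt0 // mulr_gt0.
have d1M : 2 * (M * d1) = Num.min 1 d.
  by rewrite mulrA [_ * d1]mulrC /d1 divfK // gt_eqF // mulr_gt0.
have min1 : Num.min 1 d <= 1 by rewrite ge_min lexx.
have mind : Num.min 1 d <= d by rewrite ge_min lexx orbT.
have td0 : 0 < t * d1 by rewrite mulr_gt0.
have ctd0 : 0 <= 4 * c * t ^+ 2 * d1 by rewrite mulr_ge0 // ltW.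
have Md1 : d1 + 2 * (t * d1) + 4 * c * t ^+ 2 * d1 = Num.min 1 d / 2.
  by rewrite -d1M /M; field.
have d1_sq : c * (t * (2 * d1)) ^+ 2 <= 4 * c * t ^+ 2 * d1.
  have -> : c * (t * (2 * d1)) ^+ 2 = 4 * c * t ^+ 2 * d1 * d1 by ring.
  by rewrite ler_piMr //; lra.
have [d2 d20 start] := MiFB_start R_proper F_quad L_gt0 gamma_lo_gt0 gamma_ge
  gammaL_le th_lt1 a_le2 b_le2 xmin Pfin (maxn N 1) d10.
apply/nbhs_enormP; exists d2 => // x0 x0d x xP xE.
have {}start := start x xP; rewrite xE in start.
apply: (MiFB_local (xbar := xstar) (eta := eta) (phi := phi) (rho := rho) (d := d)
  (d1 := d1) R_proper L_gt0 F_grad_lip F_quad mu_gt0 nu_gt0 gamma_lo_gt0 gamma_ge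
  gammaL_le1 a_le2 b_le2 al_ge0 al_lt_be be_le al_ge xP Phi_ge Phi_lsc) => //.
- by move=> y /rhoU; exact: kl.
- by rewrite -/c -/t; lra.
- by rewrite -/t; lra.
- by lra.
- by move=> j jK; have [] := start x0d j jK.
- by have [_] := start x0d (maxn N 1) (leqnn _); apply; exact: leq_maxr.
Qed.
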